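(* Let $H\in(0,1)\setminus\{\frac12\}$ and let $t\ge s>0$ be fixed. (1) For $t=s$, as $u\to s-$, $$\hat r_H(s,s|u)=\frac{d_H^2}{2H}(s-u)^{2H}+o\left((s-u)^{2H}\right).$$ (2) For $t>s$, as $u\to s-$, $$\hat r_H(t,s|u)=C_{H,t,s}(s-u)^{H+\frac12}+o\left((s-u)^{H+\frac12}\right),$$ where $$C_{H,t,s}=\frac{d_H^2}{H+\frac12}\left[\left(\frac{t}{s}\right)^{H-\frac12}(t-s)^{H-\frac12}+\left(\frac12-H\right)s^{H-\frac12}\int_1^{\frac{t}{s}}w^{H-\frac32}(w-1)^{H-\frac12}\,\mathrm{d}w\right].$$
   Context: For $H\in(0,1)$ let $r_H(t,s)=\frac12\left[t^{2H}+s^{2H}-|t-s|^{2H}\right]$ be the covariance of fractional Brownian motion $B^H$ with Hurst index $H$, and for $0<v<t$ let $$k_H(t,v)=d_H\left[\left(\tfrac{t}{v}\right)^{H-\frac12}(t-v)^{H-\frac12}-\left(H-\tfrac12\right)v^{\frac12-H}\int_v^t z^{H-\frac32}(z-v)^{H-\frac12}\,\mathrm{d}z\right],\qquad d_H=\sqrt{\frac{2H\,\Gamma(\frac32-H)}{\Gamma(H+\frac12)\Gamma(2-2H)}}.$$ It is a known fact that $B^H_t=\int_0^t k_H(t,v)\,\mathrm{d}W_v$ for a Brownian motion $W$ generating the same filtration as $B^H$. The conditional covariance of $B^H_t$ and $B^H_s$ given $\mathcal{F}_u=\sigma(B^H_v:v\le u)$ is, for $0<u<s\le t$, $$\hat r_H(t,s|u)=r_H(t,s)-\int_0^u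 k_H(t,v)k_H(s,v)\,\mathrm{d}v.$$ *)

(* Defs.v *)
From HB Require Import structures.
From mathcomp Require Import all_boot all_order all_algebra.
From mathcomp Require Import all_classical all_reals all_analysis.

Set Implicit Arguments.
Unset Strict Implicit.
Unset Printing Implicit Defensive.

Import Order.TTheory GRing.Theory Num.Theory.
Import numFieldNormedType.Exports.

Local Open Scope classical_set_scope.
Local Open Scope ring_scope.

(* All integrals are Lebesgue integrals over open intervals: the integrands may
   be singular at the endpoints, where [powR] and division take junk values. *)

Section FractionalBrownianMotion.
Variable R : realType.
Implicit Types H t s u v x : R.

Local Notation leb := (@lebesgue_measure R).

(* Euler's Gamma function; meaningful for 0 < x. *)
Definition Gamma x : R :=
  \int[leb]_(y in `]0, +oo[) (y `^ (x - 1) * expR (- y)).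

(* Covariance of fractional Brownian motion; [0 `^ (2 * H) = 0] for H != 0. *)
Definition fbm_cov H t s : R :=
  2^-1 * (t `^ (2 * H) + s `^ (2 * H) - `|t - s| `^ (2 * H)).

Definition fbm_const H : R :=
  Num.sqrt (2 * H * Gamma (3 / 2 - H) / (Gamma (H + 1 / 2) * Gamma (2 - 2 * H))).

(* The Volterra kernel k_H(t, v), meaningful for 0 < v < t. *)
Definition fbm_kernel H t v : R :=
  fbm_const H *
  ((t / v) `^ (H - 1 / 2) * (t - v) `^ (H - 1 / 2)
   - (H - 1 / 2) * v `^ (1 / 2 - H) *
     \int[leb]_(z in `]v, t[) (z `^ (H - 3 / 2) * (z - v) `^ (H - 1 / 2))).

(* Conditional covariance of B^H_t and B^H_s given sigma(B^H_v : v <= u),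
   through its Volterra representation; meaningful for 0 < u < s <= t. *)
Definition fbm_cond_cov H t s u : R :=
  fbm_cov H t s - \int[leb]_(v in `]0, u[) (fbm_kernel H t v * fbm_kernel H s v).

Definition cond_cov_const H t s : R :=
  fbm_const H ^+ 2 / (H + 1 / 2) *
  ((t / s) `^ (H - 1 / 2) * (t - s) `^ (H - 1 / 2)
   + (1 / 2 - H) * s `^ (H - 1 / 2) *
     \int[leb]_(w in `]1, t / s[) (w `^ (H - 3 / 2) * (w - 1) `^ (H - 1 / 2))).

End FractionalBrownianMotion.

(* Main.v *)
Require Import Defs.
From mathcomp Require Import all_boot all_order all_algebra.
From mathcomp Require Import all_classical all_reals all_analysis.
From mathcomp Require Import measurable_realfun ring lra.

Set Implicit Arguments.
Unset Strict Implicit.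
Unset Printing Implicit Defensive.

Import Order.TTheory GRing.Theory Num.Theory.
Import numFieldNormedType.Exports.

Local Open Scope classical_set_scope.
Local Open Scope ring_scope.

(* Write [a = H - 1/2].  Everything rests on the identity
   [int_0^s k_H(t, v) k_H(s, v) dv = r_H(t, s)], which turns the conditional
   covariance into [int_u^s k_H(t, v) k_H(s, v) dv]; the expansions follow since
   [k_H(s, v) ~ d_H (s - v)^a] and [k_H(t, v) -> k_H(t, s)] as [v -> s-], t > s.

   For [a > 0] the kernel is [d_H v^(-a) a int_v^t z^a (z - v)^(a - 1) dz]; by
   Tonelli the identity reduces to the integrals of
   [v^(-2a) (z - v)^(a - 1) (w - v)^(a - 1)], which Feynman's formula gives as a
   multiple of [(z w)^(-a) |z - w|^(2a - 1)].
   For [a < 0] one integrates from [t] to infinity instead: the kernel is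
   [d_H v^(-a)] times
   [cov_coef a / 2 v^(2a) - a int_t^oo z^a (z - v)^(a - 1) dz], and the integrals
   of [v^(-2a) (z - v)^a (w - v)^(a - 1)] that arise reduce to Feynman's formula
   after writing [(w - v)^(a - 1)] as an integral of [(x - v)^(a - 2)], [x > w]. *)

(** The obstacle is that all integrands are singular, while Tonelli's theorem, additivity and
    changes of variables require nonnegativity or integrability. The covariance identity is
    therefore computed with extended-real integrals of nonnegative functions over the whole line,
    the domains being carried by truncated powers; integrability of [k_H(t, v) k_H(s, v)] on []0,
    s[] is then read off from the finite value of its integral. This imposes the two sign cases. For
    [a > 0] the definition of the kernel is a difference of positive terms, and the single integral
    replaces it by a nonnegative integrand. For [a < 0] the definition is already a sum of
    nonnegative terms, but [(z - v)^(a - 1)] is not integrable at [z = v], hence the passage to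
    [z > t]; there the new form is used for the kernel at [t] and the original one for the kernel at
    [s]. The constant [d_H] enters the identity through [d_H^2 cov_coef a = 2 H]. *)

Section Preliminaries.
Variable R : realType.
Implicit Types (a b c d p q r s t u v w x y : R).
Local Notation mu := (@lebesgue_measure R).

Lemma measurable_affine c d : measurable_fun [set: measurableTypeR R]
  ((fun x => c * x + d) : _ -> measurableTypeR R).
Proof. by apply: measurable_funD => //; exact: measurable_funM. Qed.

(** The image measure rescaled by [c] agrees with Lebesgue measure on the intervals []a, b]], and
    these determine it. *)
Lemma lebesgue_measure_affine c d (c_gt0 : 0 < c) (A : set R) : measurable A ->
  mu A = (c%:E * mu ((fun x => (c * x + d)%R) @^-1` A)%classic)%E.
Proof.
move=> mA; have mf := measurable_affine c d.
apply: (@lebesgue_measure_unique R (mscale (NngNum (ltW c_gt0)) (pushforward mu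
    ((fun x => c * x + d) : measurableTypeR R -> measurableTypeR R)))) => //=.
move=> _ [[a b]] _ <-.
rewrite /mscale/= /pushforward.
have -> : (fun x : R => c * x + d) @^-1` `]a, b] = `](a - d) / c, (b - d) / c]%classic.
  apply/seteqP; split => x /=; rewrite !in_itv/= ltr_pdivrMr// ler_pdivlMr//;
  by rewrite ltrBlDr lerBrDr (mulrC x c).
rewrite !lebesgue_measure_itv/= !lte_fin ltr_pM2r ?invr_gt0// ltrD2r.
case: ifPn => ab; last by rewrite mule0.
rewrite -!EFinD -EFinM; congr (_%:E).
by rewrite -mulrBl mulrCA divff ?gt_eqF// mulr1 opprB addrA subrK.
Qed.

Lemma ge0_integral_affine c d (f : R -> \bar R) : 0 < c ->
  measurable_fun setT f -> (forall x, 0 <= f x)%E ->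
  (\int[mu]_x f x = c%:E * \int[mu]_x f (c * x + d)%R)%E.
Proof.
move=> c0 mf f0; have mg := measurable_affine c d.
rewrite (@eq_measure_integral _ _ _ setT (mscale (NngNum (ltW c0)) (pushforward mu
    ((fun x => c * x + d) : measurableTypeR R -> measurableTypeR R)))).
  by rewrite ge0_integral_mscale// ge0_integral_pushforward.
by move=> A mA _; exact: (lebesgue_measure_affine d c0 mA).
Qed.

Lemma ge0_integral_shift d (f : R -> \bar R) :
  measurable_fun setT f -> (forall x, 0 <= f x)%E ->
  (\int[mu]_x f (x + d)%R = \int[mu]_x f x)%E.
Proof.
move=> mf f0; rewrite [RHS](@ge0_integral_affine 1 d)// mul1e.
by apply: eq_integral => x _; rewrite mul1r.
Qed.

Lemma ge0_integralN (f : R -> \bar R) :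
  measurable_fun setT f -> (forall x, 0 <= f x)%E ->
  (\int[mu]_x f (- x)%R = \int[mu]_x f x)%E.
Proof.
move=> mf f0.
transitivity (\int[pushforward mu (-%R : _ -> measurableTypeR R)]_x f x)%E.
  by rewrite ge0_integral_pushforward.
by apply: eq_measure_integral => A mA _; exact: lebesgue_measureN.
Qed.

Lemma ge0_integral_reflect d (f : R -> \bar R) :
  measurable_fun setT f -> (forall x, 0 <= f x)%E ->
  (\int[mu]_x f (d - x)%R = \int[mu]_x f x)%E.
Proof.
move=> mf f0; rewrite -(ge0_integralN mf)// -[RHS](@ge0_integral_shift (- d))//.
  by apply: eq_integral => x _; rewrite opprD opprK addrC.
by apply: (measurableT_comp mf); exact: oppr_measurable.
Qed.

Lemma ge0_integral_swap (F : R -> R -> \bar R) :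
  measurable_fun setT (fun z : R * R => F z.1 z.2) ->
  (forall x y, 0 <= F x y)%E ->
  (\int[mu]_x \int[mu]_y F x y = \int[mu]_y \int[mu]_x F x y)%E.
Proof.
move=> mF F0.
by rewrite (@fubini_tonelli _ _ _ _ _ mu mu (fun z : R * R => F z.1 z.2)).
Qed.

Lemma measurable_integral_fst (F : R -> R -> \bar R) :
  measurable_fun setT (fun z : R * R => F z.1 z.2) ->
  (forall x y, 0 <= F x y)%E ->
  measurable_fun setT (fun x => \int[mu]_y F x y)%E.
Proof.
move=> mF F0.
exact: (@measurable_fun_fubini_tonelli_F _ _ _ _ _ mu (fun z : R * R => F z.1 z.2)).
Qed.

(* The truncated power [x_+^p]: it vanishes for [x <= 0], whereas
   [powR] takes junk values there. *)
Definition tpow p x : R := if 0 < x then x `^ p else 0.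

Lemma tpow_ge0 p x : 0 <= tpow p x.
Proof. by rewrite /tpow; case: ifP => // _; exact: powR_ge0. Qed.

Lemma tpowE p x : 0 < x -> tpow p x = x `^ p.
Proof. by rewrite /tpow => ->. Qed.

Lemma tpow_le0 p x : x <= 0 -> tpow p x = 0.
Proof. by rewrite /tpow ltNge => ->. Qed.

Lemma tpow_gt0 p x : 0 < x -> 0 < tpow p x.
Proof. by move=> x0; rewrite tpowE// powR_gt0. Qed.

Lemma tpowD p q x : tpow (p + q) x = tpow p x * tpow q x.
Proof.
rewrite /tpow; case: ifP => x0; last by rewrite mulr0.
by rewrite powRD// (@gt_eqF _ _ x)// implybT.
Qed.

Lemma tpowMr p q x : tpow p x * tpow q x = tpow (p + q) x.
Proof. by rewrite tpowD. Qed.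

Lemma tpowM p c x : 0 < c -> tpow p (c * x) = tpow p c * tpow p x.
Proof.
move=> c0; rewrite /tpow pmulr_rgt0// c0; case: ifPn => x0; last by rewrite mulr0.
by rewrite powRM// ltW.
Qed.

Lemma tpowV p x : 0 < x -> tpow (- p) x = (tpow p x)^-1.
Proof. by move=> x0; rewrite !tpowE// powRN. Qed.

(** With exponent 0 the truncated power is the indicator of the positive half-line. Factors such as
    [tpow 0 (b - x)] encode the integration domains from here on. *)
Lemma tpow0 x : 0 < x -> tpow 0 x = 1.
Proof. by move=> x0; rewrite tpowE// powRr0. Qed.

Lemma tpow1 x : 0 < x -> tpow 1 x = x.
Proof. by move=> x0; rewrite tpowE// powRr1// ltW. Qed.

Lemma measurable_tpow p : measurable_fun setT (tpow p).
Proof.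
apply: measurable_fun_ifT => //=.
by apply: measurable_fun_ltr.
Qed.

Lemma measurable_tpow_comp dd (T : measurableType dd) (f : T -> R) p :
  measurable_fun setT f -> measurable_fun setT (fun z => tpow p (f z)).
Proof. by move=> mf; apply: (measurableT_comp (measurable_tpow p)). Qed.

Lemma measurable_expR_comp dd (T : measurableType dd) (f : T -> R) :
  measurable_fun setT f -> measurable_fun setT (fun z => expR (f z)).
Proof. by move=> mf; apply: (measurableT_comp (@measurable_expR R)). Qed.

Lemma measurable_oppr_comp dd (T : measurableType dd) (f : T -> R) :
  measurable_fun setT f -> measurable_fun setT (fun z => - f z).
Proof. by move=> mf; apply: (measurableT_comp (@oppr_measurable R setT)). Qed.

Lemma measurable_EFin_comp dd (T : measurableType dd) (f : T -> R) :
  measurable_fun setT f -> measurable_fun setT (fun z => (f z)%:E).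
Proof. by move=> mf; apply/measurable_EFinP. Qed.

End Preliminaries.

Ltac meas := repeat first
  [ exact: measurable_cst | exact: measurable_fst | exact: measurable_snd
  | exact: measurable_id | assumption
  | apply: measurable_EFin_comp | apply: measurable_tpow_comp | apply: measurable_expR_comp
  | apply: measurable_funM | apply: measurable_funB | apply: measurable_funD
  | apply: measurable_oppr_comp ].

Ltac nonneg := move=> *; rewrite ?lee_fin; repeat
  lazymatch goal with
  | |- is_true (_ <= tpow _ _) => exact: tpow_ge0
  | |- is_true (_ <= expR _) => exact: expR_ge0
  | |- is_true (_ <= _ * _) => apply: mulr_ge0
  | _ => first [ assumption | exact: ltW | exact: tpow_ge0 | apply: mulr_ge0 | apply: addr_ge0 ]
  end.

(** * Elementary integrals of powers, by the fundamental theorem of calculus *)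

Section PowerIntegrals.
Variable R : realType.
Implicit Types (a b c d p q r s t u v w x y : R).
Local Notation mu := (@lebesgue_measure R).

(** The bridge from interval integrals of [powR], as in the definitions, to whole-line integrals of
    [tpow], the form suited to Tonelli's theorem. *)
Lemma integral_restrictE (D : set R) (f g : R -> R) :
  (forall x, D x -> f x = g x) -> (forall x, ~ D x -> g x = 0) ->
  (\int[mu]_(x in D) (f x)%:E = \int[mu]_x (g x)%:E)%E.
Proof.
move=> fg g0; rewrite integral_mkcond; apply: eq_integral => x _.
rewrite patchE; case: ifPn => [/set_mem Dx|/negP xD]; first by rewrite fg.
by rewrite g0// => Dx; apply: xD; rewrite inE.
Qed.

Lemma ge0_integralZl_real c (f : R -> R) : 0 <= c ->
  measurable_fun setT f -> (forall x, 0 <= f x) ->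
  (\int[mu]_x (c * f x)%:E = c%:E * \int[mu]_x (f x)%:E)%E.
Proof.
move=> c0 mf f0; rewrite -ge0_integralZl//=.
- exact/measurable_EFinP.
- by move=> x _; rewrite lee_fin.
Qed.

Lemma powR_cvgy0 c : c < 0 -> (x `^ c : R) @[x --> +oo] --> (0 : R).
Proof.
move=> c0; apply/cvgrPdist_lt => e e0; near=> x.
have x0 : 0 < x by near: x; exact: nbhs_pinfty_gt.
have xe : e `^ c^-1 < x by near: x; apply: nbhs_pinfty_gt; exact: num_real.
rewrite sub0r normrN ger0_norm ?powR_ge0//.
have nc0 : 0 < - c by rewrite oppr_gt0.
have := gt0_ltr_powR nc0 (powR_ge0 _ _ : e `^ c^-1 \in Num.nneg) (ltW x0 : x \in Num.nneg) xe.
rewrite -powRrM mulrN mulVf ?lt_eqF// powR_inv1 ?ltW// powRN.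
by rewrite ltf_pV2// posrE powR_gt0.
Unshelve. all: by end_near. Qed.

Lemma integral_powR_itvy w c : 0 < w -> c < 0 ->
  (\int[mu]_(x in `[w, +oo[) (x `^ (c - 1))%:E = (w `^ c / - c)%:E)%E.
Proof.
move=> w0 c0.
have dF x : 0 < x -> is_derive x 1 (fun x => x `^ c / c) (x `^ (c - 1)).
  move=> x0; have := @is_derive1_powR R c x x0 => H.
  have -> : x `^ (c - 1) = c^-1 *: (c * x `^ (c - 1)).
    by rewrite /GRing.scale /= mulKf// lt_eqF.
  rewrite (_ : (fun x => _) = c^-1 *: (@powR R ^~ c)); first exact: is_deriveZ.
  by apply/funext => y /=; rewrite mulrC.
have cF x : 0 < x -> {for x, continuous (fun x => x `^ c / c)}.
  move=> x0; apply: differentiable_continuous; apply/derivable1_diffP.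
  by have [] := dF _ x0.
have cf x : 0 < x -> {for x, continuous (@powR R ^~ (c - 1))}.
  move=> x0; apply: differentiable_continuous; apply/derivable1_diffP.
  by have [] := @is_derive1_powR R (c - 1) x x0.
rewrite (@ge0_continuous_FTC2y _ _ (fun x => x `^ c / c) _ 0).
- by rewrite sub0e -EFinN; congr (_%:E); rewrite invrN mulrN.
- by move=> x _; exact: powR_ge0.
- apply/continuous_within_itvcyP; split.
    by move=> x; rewrite in_itv/= andbT => /(lt_trans w0); exact: cf.
  by apply: cvg_at_right_filter; exact: cf.
- by rewrite -[X in _ --> X](mul0r c^-1); apply: cvgMl; exact: powR_cvgy0.
- by move=> x wx; have [] := dF _ (lt_trans w0 wx).
- by apply: cvg_at_right_filter; exact: cF.
- move=> x; rewrite in_itv/= andbT => wx; rewrite derive1E.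
  by have [] := dF _ (lt_trans w0 wx).
Qed.

(** For [p < 1] the integrand is unbounded at [b], so the primitive is used only up to
    [b - 1/(n+1)]. Monotone convergence in [n] then gives [integral_powR_itv]. *)
Lemma integral_powR_itv_shrink b p n : 0 < p -> n.+1%:R^-1 < b ->
  (\int[mu]_(x in `[0%R, (b - n.+1%:R^-1)%R]) ((b - x) `^ (p - 1))%:E
    = (b `^ p / p - n.+1%:R^-1 `^ p / p)%:E)%E.
Proof.
move=> p0 nb; set e : R := _^-1.
have e0 : 0 < e by rewrite invr_gt0.
have b0 : 0 < b by rewrite (lt_trans e0).
have dB x : is_derive x 1 (fun x => b - x) (-1).
  rewrite -[X in is_derive _ _ _ X]add0r.
  by apply: is_deriveD; exact: is_deriveN.
have dF x : x < b -> is_derive x 1 (fun x => - ((b - x) `^ p / p)) ((b - x) `^ (p - 1)).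
  move=> xb; have bx0 : 0 < b - x by rewrite subr_gt0.
  have H := @is_derive1_comp R (@powR R ^~ p) (fun x => b - x) x _ _ (@is_derive1_powR R p _ bx0) (dB x).
  have -> : (b - x) `^ (p - 1) = (- p^-1) *: (p * (b - x) `^ (p - 1) * -1).
    by rewrite /GRing.scale /= mulrN1 mulrNN mulKf// gt_eqF.
  rewrite (_ : (fun x => _) = (- p^-1) *: (@powR R ^~ p \o (fun x => b - x))); first exact: is_deriveZ.
  apply/funext => y; transitivity (- p^-1 * (b - y) `^ p) => //.
  by rewrite mulNr mulrC.
have cF x : x < b -> {for x, continuous (fun x => - ((b - x) `^ p / p))}.
  move=> x0; apply: differentiable_continuous; apply/derivable1_diffP.
  by have [] := dF _ x0.
have cf x : x < b -> {for x, continuous (fun x => (b - x) `^ (p - 1))}.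
  move=> xb; have bx0 : 0 < b - x by rewrite subr_gt0.
  have H := @is_derive1_comp R (@powR R ^~ (p - 1)) (fun x => b - x) x _ _ (@is_derive1_powR R (p - 1) _ bx0) (dB x).
  apply: differentiable_continuous; apply/derivable1_diffP.
  by have [] := H.
have beb : b - e < b by rewrite ltrBlDr ltrDl.
have be0 : 0 < b - e by rewrite subr_gt0.
rewrite (@continuous_FTC2 _ _ (fun x => - ((b - x) `^ p / p))).
- by rewrite -EFinD; congr (_%:E); rewrite subr0 opprK subKr addrC.
- exact: be0.
- apply/continuous_within_itvP => //; split.
  + by move=> x; rewrite in_itv/= => /andP[_ /lt_trans] => /(_ _ beb); exact: cf.
  + by apply: cvg_at_right_filter; exact: cf.
  + by apply: cvg_at_left_filter; exact: cf.
- split.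
  + by move=> x; rewrite in_itv/= => /andP[_ /lt_trans] => /(_ _ beb) /dF[].
  + by apply: cvg_at_right_filter; exact: cF.
  + by apply: cvg_at_left_filter; exact: cF.
- move=> x; rewrite in_itv/= derive1E => /andP[_ /lt_trans] => /(_ _ beb) xb.
  by have [] := dF _ xb.
Qed.

Lemma integral_powR_itv b p : 0 < b -> 0 < p ->
  (\int[mu]_(x in `[0%R, b[) ((b - x) `^ (p - 1))%:E = (b `^ p / p)%:E)%E.
Proof.
move=> b0 p0.
have mf : measurable_fun setT (fun x => ((b - x) `^ (p - 1))%:E).
  by apply/measurable_EFinP; apply: (measurableT_comp (measurable_powR _)) => //; exact: measurable_funB.
rewrite itv_bnd_open_bigcup.
pose F n := `[0%R, (b - n.+1%:R^-1)%R]%classic.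
have H : (\int[mu]_(x in F n) ((b - x) `^ (p - 1))%:E @[n --> \oo] -->
    \int[mu]_(x in \bigcup_n F n) ((b - x) `^ (p - 1))%:E)%E.
  apply: ge0_nondecreasing_set_cvg_integral.
  - rewrite /F; apply/nondecreasing_seqP => n; apply/subsetPset => x /=; rewrite !in_itv/= => /andP[-> /le_trans]; apply.
    by rewrite lerD2l lerN2 lef_pV2 ?posrE// ler_nat.
  - by move=> n; exact: measurable_itv.
  - by move=> n; exact: measurable_funTS.
  - by move=> n x _; rewrite lee_fin powR_ge0.
apply/esym; apply: (cvg_unique _ _ H) => //.
apply: (@cvg_trans _ ((b `^ p / p - n.+1%:R^-1 `^ p / p)%:E @[n --> \oo])).
    apply: near_eq_cvg; near=> n; rewrite integral_powR_itv_shrink//.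
    by near: n; exact: near_infty_natSinv_lt (PosNum b0).
  apply: cvg_EFin; first by near=> n.
  rewrite -[X in _ --> X]subr0; apply: cvgB; first exact: cvg_cst.
  rewrite -[X in _ --> X](mul0r p^-1); apply: cvgMl.
  (* The harmonic sequence is positive, so it converges along the right-hand filter at 0 on which
     [powR_cvg0] is stated. *)
  apply: (@cvg_comp _ _ _ (fun n => n.+1%:R^-1 : R) (@powR R ^~ p) _ (0^'+)); last exact: powR_cvg0.
  move=> A HA; have HH : \forall n \near \oo, 0 < (n.+1%:R^-1 : R) -> A n.+1%:R^-1.
    exact: (@cvg_harmonic R _ HA).
  change (\forall n \near \oo, A n.+1%:R^-1).
  by apply: filterS HH => n; apply; rewrite invr_gt0 ltr0Sn.
Unshelve. all: by end_near. Qed.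

(** Both sides vanish when [b <= a]; without an order hypothesis, inner integrals can be evaluated
    with no case distinction on the outer variable. *)
Lemma integral_tpow_left p a b : 0 < p ->
  (\int[mu]_x (tpow (p - 1) (x - a) * tpow 0 (b - x))%:E = (tpow p (b - a) / p)%:E)%E.
Proof.
move=> p0; have [ab|ba] := ltP a b; last first.
  rewrite tpow_le0 ?subr_le0// mul0r; apply: integral0_eq => x _.
  have [xa|ax] := lerP x a; first by rewrite tpow_le0 ?subr_le0// mul0r.
  by rewrite [tpow 0 _]tpow_le0 ?mulr0// subr_le0 (le_trans ba)// ltW.
rewrite tpowE ?subr_gt0// -integral_powR_itv ?subr_gt0//.
rewrite -(@ge0_integral_reflect R b); last 2 first.
- by meas.
- by move=> x; rewrite lee_fin mulr_ge0// tpow_ge0.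
rewrite -integral_itv_obnd_cbnd; last first.
  apply: measurable_funTS; apply/measurable_EFinP.
  by apply: (measurableT_comp (measurable_powR _)) => //; exact: measurable_funB.
apply/esym/integral_restrictE => x /=; rewrite in_itv/=.
  move=> /andP[x0 xb]; rewrite subKr tpow0// mulr1 tpowE; first by rewrite addrAC.
  by rewrite addrAC subr_gt0.
move=> /negP; rewrite negb_and -!leNgt => /orP[x0|xb].
  by rewrite [tpow 0 _]tpow_le0 ?mulr0// subKr.
by rewrite tpow_le0 ?mul0r// addrAC subr_le0.
Qed.

Lemma integral_tpow_right w c : 0 < w -> c < 0 ->
  (\int[mu]_x (tpow 0 (x - w) * tpow (c - 1) x)%:E = (tpow c w / - c)%:E)%E.
Proof.
move=> w0 c0; rewrite [tpow c w]tpowE// -integral_powR_itvy//.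
rewrite -integral_itv_obnd_cbnd; last first.
  by apply: measurable_funTS; apply/measurable_EFinP; exact: measurable_powR.
apply/esym/integral_restrictE => x /=; rewrite in_itv/= andbT => wx.
  by rewrite tpow0 ?subr_gt0// mul1r tpowE// (lt_trans w0).
by rewrite tpow_le0 ?mul0r// subr_le0 leNgt; apply/negP.
Qed.

End PowerIntegrals.

(** * Euler's Gamma function: finiteness, positivity, functional equation *)

Section GammaFunction.
Variable R : realType.
Implicit Types (a b c d p q r s t u v w x y : R).
Local Notation mu := (@lebesgue_measure R).
Local Notation G := (@Gamma R).

Lemma gamma_integrand_ge0 p x : 0 <= tpow (p - 1) x * expR (- x).
Proof. by rewrite mulr_ge0 ?tpow_ge0 ?expR_ge0. Qed.

(** Take [y <= exp y] at [y = x / (n+1)], raise it to the power [n+1] and invert. *)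
Lemma expRN_le_powR n x : 1 <= x ->
  expR (- x) <= n.+1%:R ^+ n.+1 * x `^ (- n.+1%:R).
Proof.
move=> x1; have x0 : 0 < x by rewrite (lt_le_trans _ x1).
rewrite powRN powR_mulrn ?(ltW x0)// expRN -[X in _ <= X]invrK lef_pV2 ?posrE ?expR_gt0//; last first.
  by rewrite invr_gt0 mulr_gt0 ?invr_gt0 ?exprn_gt0.
rewrite invfM invrK -exprVn -exprMn mulrC.
have -> : expR x = expR (x / n.+1%:R) ^+ n.+1.
  by rewrite -expRM_natl mulrC divfK.
rewrite lerXn2r ?nnegrE ?expR_ge0 ?divr_ge0 ?(ltW x0)//.
by rewrite (le_trans _ (expR_ge1Dx _))// lerDr.
Qed.

Lemma gamma_integral_lty p : 0 < p ->
  (\int[mu]_x (tpow (p - 1) x * expR (- x))%:E < +oo)%E.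
Proof.
(* The integrand is dominated by [x^(p-1)] below 2 and by [K x^(-2)] above 1/2. The decay exponent
   [n+2] is at least [p+1], so that [x^(p-1) x^(-(n+2)) <= x^(-2)]. The two ranges overlap, so no
   boundary point needs care. *)
move=> p0; pose n := Num.truncn p; pose K : R := n.+1.+1%:R ^+ n.+2.
pose f x := tpow (p - 1) (x - 0) * tpow 0 (2 - x).
pose g x := K * (tpow 0 (x - 2^-1) * tpow (-1 - 1) x).
have K0 : 0 <= K by rewrite exprn_ge0.
have f0 x : 0 <= f x by nonneg.
have g0 x : 0 <= g x by nonneg.
have mf : measurable_fun setT f by rewrite /f; meas.
have mg : measurable_fun setT g by rewrite /g; meas.
apply: (@le_lt_trans _ _ (\int[mu]_x ((f x)%:E + (g x)%:E))%E).
  apply: ge0_le_integral => //.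
  - by move=> x _; rewrite lee_fin gamma_integrand_ge0.
  - by meas.
  - by apply: emeasurable_funD; meas.
  - move=> x _; rewrite -EFinD lee_fin /f /g subr0.
    have [x0|x0] := lerP x 0; first by rewrite tpow_le0// !mul0r add0r; nonneg.
    have [x2|x2] := ltP x 2.
      rewrite [tpow 0 (2 - x)]tpow0 ?subr_gt0// mulr1 ler_wpDr//; first exact: g0.
      by rewrite ler_piMr ?tpow_ge0// -expR0 ler_expR oppr_le0 ltW.
    rewrite ler_wpDl ?mulr_ge0 ?tpow_ge0// tpow0 ?mul1r; last by lra.
    rewrite !tpowE// (le_trans (ler_wpM2l (powR_ge0 _ _) (expRN_le_powR n.+1 _)))//; first by lra.
    rewrite mulrCA ler_wpM2l// -powRD; last by rewrite (@gt_eqF _ _ x) ?implybT.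
    apply: ler_powR; first by lra.
    have := ltW (truncnS_gt p); rewrite -/n => /(le_trans) H.
    have : p <= n.+1%:R by apply: ltW; exact: truncnS_gt.
    rewrite -[n.+2]addn1 natrD; lra.
rewrite ge0_integralD//; [|by move=> x _; rewrite lee_fin|by meas|by move=> x _; rewrite lee_fin|by meas].
rewrite integral_tpow_left// ge0_integralZl_real//; [|by meas|by move=> x; rewrite mulr_ge0 ?tpow_ge0].
have h0 : 0 < 2^-1 :> R by rewrite invr_gt0.
have h1 : -1 < 0 :> R by rewrite oppr_lt0.
by rewrite (integral_tpow_right h0 h1) -EFinM -EFinD ltry.
Qed.

Lemma GammaE p : 0 < p ->
  (\int[mu]_x (tpow (p - 1) x * expR (- x))%:E = (G p)%:E)%E.
Proof.
move=> p0; rewrite /Gamma /Rintegral.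
rewrite (_ : \int[mu]_(x in _) _ = \int[mu]_x (tpow (p - 1) x * expR (- x))%:E)%E.
  rewrite fineK// ge0_fin_numE ?gamma_integral_lty//.
  by apply: integral_ge0 => x _; rewrite lee_fin gamma_integrand_ge0.
apply: integral_restrictE.
- by move=> x /=; rewrite in_itv/= andbT => x0; rewrite tpowE.
- move=> x /=; rewrite in_itv/= andbT => /negP; rewrite -leNgt => x0.
  by rewrite tpow_le0// mul0r.
Qed.

(** Bounded below by the part over []0, 1[], where [exp(-x) >= exp(-1)]. *)
Lemma Gamma_gt0 p : 0 < p -> 0 < G p.
Proof.
move=> p0; rewrite -lte_fin -GammaE//.
apply: (@lt_le_trans _ _ (\int[mu]_x (expR (- 1) * (tpow (p - 1) (x - 0) * tpow 0 (1 - x)))%:E)%E).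
  rewrite ge0_integralZl_real ?expR_ge0//.
  - rewrite integral_tpow_left// -EFinM lte_fin mulr_gt0 ?expR_gt0// divr_gt0//.
    by rewrite tpow_gt0 ?subr0.
  - by meas.
  - by move=> x; rewrite mulr_ge0 ?tpow_ge0.
apply: ge0_le_integral => //.
- by move=> x _; rewrite lee_fin !mulr_ge0 ?tpow_ge0 ?expR_ge0.
- by meas.
- by meas.
- move=> x _; rewrite lee_fin subr0.
  have [x1|x1] := ltP x 1; last by rewrite [tpow 0 _]tpow_le0 ?subr_le0// !mulr0 gamma_integrand_ge0.
  by rewrite tpow0 ?subr_gt0// mulr1 mulrC ler_wpM2l ?tpow_ge0// ler_expR lerN2 ltW.
Qed.

(** Read backwards, this trades a power [c^(-p)] for an integral of exponentials, in which sums in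
    [c] factor. It is the mechanism of [integral_feynman] and [integral_tpow_mellin]. *)
Lemma integral_tpow_expR p c : 0 < p -> 0 < c ->
  (\int[mu]_x (tpow (p - 1) x * expR (- (c * x)))%:E = (G p * tpow (- p) c)%:E)%E.
Proof.
move=> p0 c0; have cV0 : 0 < c^-1 by rewrite invr_gt0.
rewrite (@ge0_integral_affine _ c^-1 0)//; last 2 first.
- by meas.
- by move=> x; rewrite lee_fin mulr_ge0 ?tpow_ge0 ?expR_ge0.
transitivity (c^-1%:E * \int[mu]_x (tpow (p - 1) c^-1 * (tpow (p - 1) x * expR (- x)))%:E)%E.
  congr (_ * _)%E; apply: eq_integral => x _; rewrite addr0 tpowM// mulrA.
  by rewrite divff ?gt_eqF// mul1r mulrA.
rewrite ge0_integralZl_real ?tpow_ge0//; [|by meas|exact: gamma_integrand_ge0].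
rewrite GammaE// -!EFinM; congr (_%:E).
rewrite mulrA mulrC; congr (_ * _).
rewrite -{1}[c^-1]tpow1// tpowMr addrC subrK.
by rewrite !tpowE// -powR_inv1 ?ltW// -powRrM mulN1r.
Qed.

(** The total mass of the exponential distribution of rate 1. *)
Lemma Gamma1 : G 1 = 1.
Proof.
apply: EFin_inj; rewrite -GammaE//.
rewrite -(integral_exponential_pdf (@ltr01 R)).
transitivity (\int[mu]_(x in `]0%R, +oo[) (1 * expR (- 1 * x))%:E)%E.
  apply/esym/integral_restrictE => x /=; rewrite in_itv/= andbT.
    by move=> x0; rewrite mul1r mulN1r subrr tpow0// mul1r.
  by move=> /negP; rewrite -leNgt => x0; rewrite tpow_le0// mul0r.
rewrite integral_itv_obnd_cbnd; last first.
  apply: measurable_funTS; apply/measurable_EFinP.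
  by meas.
apply: integral_restrictE => x /=; rewrite in_itv/= andbT /exponential_pdf patchE.
  by move=> x0; rewrite ifT// inE/= in_itv/= x0.
by move=> /negP x0; rewrite ifF//; apply/negP; rewrite inE/= in_itv/= andbT; exact/negP.
Qed.

(** In place of an integration by parts, [y^p] is written as [p] times the integral of [w^(p-1)]
    over []0, y[]. After the exchange, the integral of [exp(-y)] over [y > w] is [exp(-w)]. *)
Lemma GammaS p : 0 < p -> G (p + 1) = p * G p.
Proof.
move=> p0; have p10 : 0 < p + 1 by rewrite addr_gt0.
apply: EFin_inj; rewrite -GammaE// EFinM -GammaE// addrK.
pose F y w := p * tpow (p - 1) w * (tpow 0 (y - w) * expR (- y)).
have F0 y w : 0 <= F y w by nonneg.
have mF : measurable_fun setT (fun z : R * R => (F z.1 z.2)%:E) by rewrite /F; meas.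
transitivity (\int[mu]_y \int[mu]_w (F y w)%:E)%E.
  apply: eq_integral => y _.
  transitivity (\int[mu]_w (p * expR (- y) * (tpow (p - 1) (w - 0) * tpow 0 (y - w)))%:E)%E.
    rewrite ge0_integralZl_real.
    - rewrite integral_tpow_left// subr0 -EFinM; congr (_%:E).
      by rewrite mulrC; field; rewrite gt_eqF.
    - by nonneg.
    - by meas.
    - by move=> x; rewrite mulr_ge0 ?tpow_ge0.
  by apply: eq_integral => w _; congr (_%:E); rewrite /F subr0; ring.
rewrite (ge0_integral_swap mF); last by move=> *; rewrite lee_fin.
transitivity (\int[mu]_x (p * (tpow (p - 1) x * expR (- x)))%:E)%E; last first.
  by rewrite ge0_integralZl_real ?(ltW p0)//; [meas|exact: gamma_integrand_ge0].
apply: eq_integral => w _; rewrite /F.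
have m1 : measurable_fun setT (fun y => tpow 0 (y - w) * expR (- y)) by meas.
rewrite ge0_integralZl_real//; last 2 first.
- by nonneg.
- by move=> x; rewrite mulr_ge0 ?tpow_ge0 ?expR_ge0.
rewrite mulrA [RHS]EFinM; congr (_ * _)%E.
rewrite -(@ge0_integral_shift _ w); [|by meas|by move=> x; rewrite lee_fin mulr_ge0 ?tpow_ge0 ?expR_ge0].
transitivity (\int[mu]_x (expR (- w) * (tpow (1 - 1) x * expR (- x)))%:E)%E.
  apply: eq_integral => x _; congr (_%:E).
  by rewrite addrK opprD expRD subrr; ring.
rewrite ge0_integralZl_real ?expR_ge0//; [|by meas|exact: gamma_integrand_ge0].
by rewrite GammaE// Gamma1 -EFinM mulr1.
Qed.

End GammaFunction.

(** * A three-factor Beta-type integral *)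

Section FeynmanIntegral.
Variable R : realType.
Implicit Types (a b c d p q r s t u v w x y : R).
Local Notation mu := (@lebesgue_measure R).
Local Notation G := (@Gamma R).

(* Feynman's parametrisation: write the Gamma factors as integrals,
   substitute [v = z x / r] and exchange the order of integration. *)
Lemma integral_feynman p q z tau : 0 < p -> 0 < q -> 0 < z -> z < tau ->
  (\int[mu]_v (tpow (p - 1) v * tpow (q - 1) (z - v) * tpow (- (p + q)) (tau - v))%:E
   = (G p * G q / G (p + q) * (tpow (p + q - 1) z * tpow (- p) (tau - z) * tpow (- q) tau))%:E)%E.
Proof.
move=> p0 q0 z0 ztau; have pq0 : 0 < p + q by rewrite addr_gt0.
have tau0 : 0 < tau by rewrite (lt_trans z0).
have tz0 : 0 < tau - z by rewrite subr_gt0.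
set I := (X in X = _).
suff H : ((G (p + q))%:E * I = (G p * G q * (tpow (p + q - 1) z * tpow (- p) (tau - z) * tpow (- q) tau))%:E)%E.
  have G0 := Gamma_gt0 pq0.
  have -> : (I = ((G (p + q))^-1)%:E * ((G (p + q))%:E * I))%E.
    by rewrite muleA -EFinM mulVf ?mul1e// gt_eqF.
  rewrite H -EFinM; congr (_%:E); ring.
pose F v r := tpow (p - 1) v * tpow (q - 1) (z - v) * (tpow (p + q - 1) r * expR (- ((tau - v) * r))).
have F0 v r : 0 <= F v r by nonneg.
have mF : measurable_fun setT (fun x : R * R => (F x.1 x.2)%:E) by rewrite /F; meas.
transitivity (\int[mu]_v \int[mu]_r (F v r)%:E)%E.
  rewrite /I -ge0_integralZl_real; [|by apply/ltW/Gamma_gt0|by meas|by nonneg].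
  apply: eq_integral => v _.
  rewrite /F ge0_integralZl_real; [|by nonneg|by meas|by nonneg].
  have [zv|vz] := lerP z v.
    by rewrite [tpow _ (z - v)]tpow_le0 ?subr_le0// !(mulr0, mul0r, mul0e).
  have tv0 : 0 < tau - v by rewrite subr_gt0 (lt_trans vz).
  rewrite integral_tpow_expR// -EFinM; congr (_%:E); ring.
rewrite (ge0_integral_swap mF); last by nonneg.
(* This is [F] after [v = z x / r], including the Jacobian [z / r]: the constraint [v < z] becomes
   [x < r], and the powers of [z / r] and [r] collect into [z^(p+q-1)]. *)
pose H x r := tpow (p + q - 1) z * (tpow (p - 1) x * (tpow (q - 1) (r - x) * expR (- (tau * r - z * x)))).
have H0 v r : 0 <= H v r by nonneg.
have mH : measurable_fun setT (fun x : R * R => (H x.1 x.2)%:E) by rewrite /H; meas.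
have mH' : measurable_fun setT (fun x : R * R => (H x.2 x.1)%:E) by rewrite /H; meas.
transitivity (\int[mu]_r \int[mu]_x (H x r)%:E)%E.
  apply: eq_integral => r _.
  have [r0|r0] := lerP r 0.
    rewrite !integral0_eq// => v _; rewrite /F/H; last by rewrite (tpow_le0 _ r0) !(mul0r, mulr0).
    have [v0|v0] := lerP v 0; first by rewrite (tpow_le0 _ v0) !(mul0r, mulr0).
    by rewrite (@tpow_le0 _ _ (r - v)) ?(mul0r, mulr0)// subr_le0 (le_trans r0) ?ltW.
  have zr0 : 0 < z / r by rewrite divr_gt0.
  rewrite (@ge0_integral_affine _ (z / r) 0 _ zr0); [|by rewrite /F; meas|by nonneg].
  rewrite -ge0_integralZl_real; [|exact: ltW|by rewrite /F; meas|by nonneg].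
  apply: eq_integral => x _; congr (_%:E).
  rewrite /F /H addr0 (tpowM _ x zr0) (_ : z - z / r * x = z / r * (r - x)); last first.
    by field; rewrite gt_eqF.
  rewrite (tpowM _ (r - x) zr0) (_ : (tau - z / r * x) * r = tau * r - z * x); last first.
    by field; rewrite gt_eqF.
  suff -> : tpow (p + q - 1) z = z / r * tpow (p - 1) (z / r) * tpow (q - 1) (z / r) * tpow (p + q - 1) r by ring.
  rewrite -{1}[z / r]tpow1// !tpowMr (_ : 1 + (p - 1) + (q - 1) = p + q - 1); last by ring.
  by rewrite -tpowM// divfK// gt_eqF.
rewrite -(ge0_integral_swap mH); last by nonneg.
transitivity (\int[mu]_x (tpow (p + q - 1) z * (G q * tpow (- q) tau) * (tpow (p - 1) x * expR (- ((tau - z) * x))))%:E)%E.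
  apply: eq_integral => x _.
  (* Replacing [r] by [r + x] turns the exponent into [(tau - z) x + tau r], and the double integral
     factors into two Gamma integrals. *)
  rewrite -(@ge0_integral_shift _ x); [|by rewrite /H; meas|by nonneg].
  transitivity (\int[mu]_r (tpow (p + q - 1) z * (tpow (p - 1) x * expR (- ((tau - z) * x))) * (tpow (q - 1) r * expR (- (tau * r))))%:E)%E.
    apply: eq_integral => r _; congr (_%:E); rewrite /H addrK.
    rewrite (_ : - (tau * (r + x) - z * x) = - ((tau - z) * x) + - (tau * r)); last by ring.
    rewrite expRD; ring.
  rewrite ge0_integralZl_real; [|by nonneg|by meas|by nonneg].
  rewrite integral_tpow_expR// -EFinM; congr (_%:E); ring.
rewrite ge0_integralZl_real; [| |by meas|by nonneg]; last first.
  by rewrite !mulr_ge0 ?tpow_ge0// ltW// Gamma_gt0.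
rewrite integral_tpow_expR// -EFinM; congr (_%:E); ring.
Qed.

End FeynmanIntegral.

(** * Splitting integrals at a point or along the diagonal *)

Section PowerIntegralVariants.
Variable R : realType.
Implicit Types (a b c d p q r s t u v w x y : R).
Local Notation mu := (@lebesgue_measure R).

(** The strict indicators on both sides of a cut vanish at the cut itself, and identities between
    kernels may fail on the diagonal; both exceptions are single points. *)
Lemma eq_integral_neq c (f g : R -> \bar R) :
  measurable_fun setT f -> measurable_fun setT g ->
  (forall x, x != c -> f x = g x) ->
  (\int[mu]_x f x = \int[mu]_x g x)%E.
Proof.
move=> mf mg fg; apply: ae_eq_integral => //.
exists [set c]; split => //; first exact: lebesgue_measure_set1.
move=> x /= H; apply: contrapT => /eqP xc; apply: H => _; exact: fg.
Qed.

Lemma ge0_integralD_real (f g : R -> R) :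
  measurable_fun setT f -> measurable_fun setT g ->
  (forall x, 0 <= f x) -> (forall x, 0 <= g x) ->
  (\int[mu]_x (f x + g x)%:E = \int[mu]_x (f x)%:E + \int[mu]_x (g x)%:E)%E.
Proof.
move=> mf mg f0 g0; rewrite -ge0_integralD//.
- by move=> x _; rewrite lee_fin.
- by meas.
- by move=> x _; rewrite lee_fin.
- by meas.
Qed.

Lemma tpow0_split c x : x != c -> tpow 0 (c - x) + tpow 0 (x - c) = 1.
Proof.
move=> xc; have [cx|xc'] := lerP c x.
  by rewrite tpow_le0 ?subr_le0// add0r tpow0// subr_gt0 lt_neqAle eq_sym xc.
by rewrite tpow0 ?subr_gt0// tpow_le0 ?addr0// subr_le0 ltW.
Qed.

Lemma ge0_integral_split c (f : R -> R) : measurable_fun setT f ->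
  (forall x, 0 <= f x) ->
  (\int[mu]_x (f x)%:E = \int[mu]_x (f x * tpow 0 (c - x))%:E
    + \int[mu]_x (f x * tpow 0 (x - c))%:E)%E.
Proof.
move=> mf f0; rewrite -ge0_integralD_real; [|by meas|by meas|by nonneg|by nonneg].
apply: (@eq_integral_neq c); [by meas|by meas|move=> x xc].
by rewrite -mulrDr tpow0_split// mulr1.
Qed.

Lemma ge0_integral_swap_half (f g : R -> R) : measurable_fun setT f ->
  measurable_fun setT g -> (forall x, 0 <= f x) -> (forall x, 0 <= g x) ->
  (\int[mu]_z ((f z)%:E * \int[mu]_w (g w * tpow 0 (w - z))%:E) =
   \int[mu]_w ((g w)%:E * \int[mu]_z (f z * tpow 0 (w - z))%:E))%E.
Proof.
move=> mf mg f0 g0.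
have m2 : measurable_fun setT (fun x : R * R => (f x.1 * g x.2 * tpow 0 (x.2 - x.1))%:E).
  by meas; [exact: (measurableT_comp mf)|exact: (measurableT_comp mg)].
transitivity (\int[mu]_z \int[mu]_w (f z * g w * tpow 0 (w - z))%:E)%E.
  apply: eq_integral => z _; rewrite -ge0_integralZl_real//; [|by meas|by nonneg].
  by apply: eq_integral => w _; rewrite mulrA.
rewrite (ge0_integral_swap m2); last by nonneg.
apply: eq_integral => w _; rewrite -ge0_integralZl_real//; [|by meas|by nonneg].
by apply: eq_integral => z _; rewrite mulrCA mulrA.
Qed.

(** The double integral is cut along the diagonal. When [f] and [g] are derivatives, the two inner
    integrals are primitives, so this is integration by parts without boundary limits. *)
Lemma ge0_integral_prod_split (f g : R -> R) : measurable_fun setT f ->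
  measurable_fun setT g -> (forall x, 0 <= f x) -> (forall x, 0 <= g x) ->
  ((\int[mu]_x (f x)%:E) * (\int[mu]_x (g x)%:E) =
   \int[mu]_z ((f z)%:E * \int[mu]_w (g w * tpow 0 (z - w))%:E) +
   \int[mu]_w ((g w)%:E * \int[mu]_z (f z * tpow 0 (w - z))%:E))%E.
Proof.
move=> mf mg f0 g0.
have m1 : measurable_fun setT (fun x : R * R => (g x.2 * tpow 0 (x.1 - x.2))%:E).
  by meas; exact: (measurableT_comp mg).
have m2 : measurable_fun setT (fun x : R * R => (g x.2 * tpow 0 (x.2 - x.1))%:E).
  by meas; exact: (measurableT_comp mg).
have p1 z : (0 <= \int[mu]_w (g w * tpow 0 (z - w))%:E)%E by apply: integral_ge0; nonneg.
have p2 z : (0 <= \int[mu]_w (g w * tpow 0 (w - z))%:E)%E by apply: integral_ge0; nonneg.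
have q1 : measurable_fun setT (fun z : R => \int[mu]_w (g w * tpow 0 (z - w))%:E)%E.
  by apply: (measurable_integral_fst m1); nonneg.
have q2 : measurable_fun setT (fun z : R => \int[mu]_w (g w * tpow 0 (w - z))%:E)%E.
  by apply: (measurable_integral_fst m2); nonneg.
rewrite -(ge0_integral_swap_half mf mg f0 g0) -ge0_integralD//; first last.
- exact: (emeasurable_funM (measurable_EFin_comp mf) q2).
- by move=> x _; apply: mule_ge0 => //; rewrite lee_fin.
- exact: (emeasurable_funM (measurable_EFin_comp mf) q1).
- by move=> x _; apply: mule_ge0 => //; rewrite lee_fin.
rewrite -ge0_integralZr//; [|by meas|by nonneg|by apply: integral_ge0; nonneg].
apply: eq_integral => z _.
by rewrite (@ge0_integral_split z g)// ge0_muleDr.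
Qed.

Lemma integral_tpow_leftN p a b : 0 < p ->
  (\int[mu]_x (tpow (p - 1) (b - x) * tpow 0 (x - a))%:E = (tpow p (b - a) / p)%:E)%E.
Proof.
move=> p0; rewrite (_ : b - a = (- a) - (- b)); last by ring.
rewrite -(integral_tpow_left (- b) (- a) p0).
rewrite -ge0_integralN; [|by meas|by nonneg].
by apply: eq_integral => x _; congr (_%:E); congr (tpow _ _ * tpow _ _); ring.
Qed.

(** Subtraction in the extended reals where finiteness of [x] is a conclusion and not a premise. *)
Lemma addeIr_real (x : \bar R) u w : (x + u%:E = w%:E)%E -> x = (w - u)%:E.
Proof. by case: x => [x [<-]| |]//; rewrite addrK. Qed.

Lemma integral_tpow_diff p a b c : 0 < p -> a <= b -> b <= c ->
  (\int[mu]_x (tpow 0 (x - a) * tpow 0 (b - x) * tpow (p - 1) (c - x))%:E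
    = ((tpow p (c - a) - tpow p (c - b)) / p)%:E)%E.
Proof.
move=> p0 ab bc; have := @integral_tpow_leftN p a c p0.
rewrite (@ge0_integral_split b); [|by meas|by nonneg].
rewrite [X in (_ + X)%E](_ : _ = (tpow p (c - b) / p)%:E); last first.
  rewrite -integral_tpow_leftN//; apply: eq_integral => x _; congr (_%:E).
  have [xb|bx] := lerP x b; first by rewrite [tpow 0 (x - b)]tpow_le0 ?subr_le0// !mulr0.
  by rewrite [tpow 0 (x - a)]tpow0 ?mulr1// subr_gt0 (le_lt_trans ab).
move=> /addeIr_real; rewrite -mulrBl => <-.
by apply: eq_integral => x _; congr (_%:E); rewrite -[RHS]mulrA [RHS]mulrC.
Qed.

Lemma integral_tpow_rightD c v w : c < 0 -> v < w ->
  (\int[mu]_x (tpow 0 (x - w) * tpow (c - 1) (x - v))%:E = (tpow c (w - v) / - c)%:E)%E.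
Proof.
move=> c0 vw; have wv0 : 0 < w - v by rewrite subr_gt0.
rewrite -(integral_tpow_right wv0 c0).
rewrite -(@ge0_integral_shift _ v); [|by meas|by nonneg].
by apply: eq_integral => x _; congr (_%:E); congr (tpow _ _ * tpow _ _); ring.
Qed.

Lemma integral_tpow_rightN c b x : c < 0 -> b < x ->
  (\int[mu]_z (tpow 0 (b - z) * tpow (c - 1) (x - z))%:E = (tpow c (x - b) / - c)%:E)%E.
Proof.
move=> c0 bx; have bx' : - x < - b by rewrite ltrN2.
rewrite (_ : x - b = - b - - x); last by ring.
rewrite -(integral_tpow_rightD c0 bx').
rewrite -ge0_integralN; [|by meas|by nonneg].
by apply: eq_integral => y _; congr (_%:E); congr (tpow _ _ * tpow _ _); ring.
Qed.

Lemma integral_tpow_diffN c a b x : c < 0 -> a <= b -> b < x ->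
  (\int[mu]_z (tpow 0 (z - a) * tpow 0 (b - z) * tpow (c - 1) (x - z))%:E
   = ((tpow c (x - b) - tpow c (x - a)) / - c)%:E)%E.
Proof.
move=> c0 ab bx; have := @integral_tpow_rightN c b x c0 bx.
rewrite (@ge0_integral_split a); [|by meas|by nonneg].
rewrite [X in (X + _)%E](_ : _ = (tpow c (x - a) / - c)%:E); last first.
  rewrite -(integral_tpow_rightN c0 (le_lt_trans ab bx)).
  apply: eq_integral => z _; congr (_%:E).
  have [az|za] := lerP a z; first by rewrite [tpow 0 (a - z)]tpow_le0 ?subr_le0// !(mulr0, mul0r).
  by rewrite [tpow 0 (b - z)]tpow0 ?mul1r 1?mulrC// subr_gt0 (lt_le_trans za).
rewrite addeC => /addeIr_real; rewrite -mulrBl => <-.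
by apply: eq_integral => z _; congr (_%:E); rewrite [RHS]mulrC [RHS]mulrA.
Qed.

End PowerIntegralVariants.

(** * Nonnegative integral representations of the kernel *)

Section VolterraKernel.
Variable R : realType.
Implicit Types (a b c d p q r s t u v w x y : R).
Local Notation mu := (@lebesgue_measure R).
Local Notation G := (@Gamma R).

Definition volterra_int a t v : R :=
  \int[mu]_(z in `]v, t[) (z `^ (a - 1) * (z - v) `^ a).

(* With [a = H - 1/2], the kernel [k_H(t, v)] is [d_H v^(-a) volterra a t v]. *)
Definition volterra a t v : R :=
  t `^ a * (t - v) `^ a - a * volterra_int a t v.

Lemma volterra_int_restrict a t v : 0 < v ->
  (\int[mu]_(z in `]v, t[) (z `^ (a - 1) * (z - v) `^ a)%:E =
   \int[mu]_z (tpow (a - 1) z * tpow a (z - v) * tpow 0 (t - z))%:E)%E.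
Proof.
move=> v0; apply: integral_restrictE => z /=; rewrite in_itv/=.
  move=> /andP[vz zt]; rewrite tpow0 ?subr_gt0// mulr1 !tpowE// ?subr_gt0//.
  by rewrite (lt_trans v0).
move=> /negP; rewrite negb_and -!leNgt => /orP[zv|tz].
  by rewrite [tpow a _]tpow_le0 ?subr_le0// mulr0 mul0r.
by rewrite [tpow 0 _]tpow_le0 ?subr_le0// mulr0.
Qed.

(** Since [a < 1], [z^(a-1) <= v^(a-1)] for [z > v]. The bound gives finiteness here and the order
    [(t - v)^(a+1)] in the asymptotics. *)
Lemma volterra_int_lee a t v : -1 < a -> a < 1 -> 0 < v ->
  (\int[mu]_z (tpow (a - 1) z * tpow a (z - v) * tpow 0 (t - z))%:E
    <= (tpow (a - 1) v * (tpow (a + 1) (t - v) / (a + 1)))%:E)%E.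
Proof.
move=> aN1 a1 v0; have a10 : 0 < a + 1 by lra.
rewrite EFinM -integral_tpow_left// -ge0_integralZl_real; [|by nonneg|by meas|by nonneg].
apply: ge0_le_integral => //; [by nonneg|by meas|by meas|].
move=> z _; rewrite lee_fin addrK mulrA.
apply: ler_wpM2r; first by nonneg.
have [zv|vz] := lerP z v; first by rewrite [tpow a _]tpow_le0 ?subr_le0// !mulr0.
apply: ler_wpM2r; first by nonneg.
have z0 : 0 < z by rewrite (lt_trans v0).
rewrite !tpowE// -[a - 1]opprK ![_ `^ (- - _)]powRN lef_pV2 ?posrE ?powR_gt0//.
rewrite ge0_ler_powR ?nnegrE ?(ltW v0) ?(ltW z0) ?(ltW vz)//; lra.
Qed.

Lemma volterra_intE a t v : -1 < a -> a < 1 -> 0 < v ->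
  (\int[mu]_z (tpow (a - 1) z * tpow a (z - v) * tpow 0 (t - z))%:E
    = (volterra_int a t v)%:E)%E.
Proof.
move=> aN1 a1 v0.
rewrite /volterra_int /Rintegral volterra_int_restrict// fineK// ge0_fin_numE.
  by rewrite (le_lt_trans (volterra_int_lee _ _ _ _))// ltry.
by apply: integral_ge0; nonneg.
Qed.

Lemma volterra_int_ge0 a t v : 0 < v -> 0 <= volterra_int a t v.
Proof.
move=> v0; rewrite /volterra_int /Rintegral volterra_int_restrict//.
by apply: fine_ge0; apply: integral_ge0; nonneg.
Qed.

Lemma volterra_int_le a t v : -1 < a -> a < 1 -> 0 < v ->
  volterra_int a t v <= tpow (a - 1) v * (tpow (a + 1) (t - v) / (a + 1)).
Proof.
by move=> aN1 a1 v0; rewrite -lee_fin -volterra_intE//; exact: volterra_int_lee.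
Qed.

(* Both [t^a] and [(t - v)^a] are integrals of powers; splitting their product along
   the diagonal replaces an integration by parts that is improper at [v]. *)
Lemma volterra_pos a t v : 0 < a -> a < 1 -> 0 < v -> v < t ->
  (\int[mu]_z (a * (tpow a z * tpow (a - 1) (z - v) * tpow 0 (t - z)))%:E
    = (volterra a t v)%:E)%E.
Proof.
move=> a0 a1 v0 vt; have t0 : 0 < t by rewrite (lt_trans v0).
have aN1 : -1 < a by lra.
pose f z := a * (tpow (a - 1) (z - 0) * tpow 0 (t - z)).
pose g w := a * (tpow (a - 1) (w - v) * tpow 0 (t - w)).
have f0 z : 0 <= f z by nonneg.
have g0 z : 0 <= g z by nonneg.
have mf : measurable_fun setT f by rewrite /f; meas.
have mg : measurable_fun setT g by rewrite /g; meas.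
have If : (\int[mu]_z (f z)%:E = (tpow a t)%:E)%E.
  rewrite /f ge0_integralZl_real ?(ltW a0)//; [|by meas|by nonneg].
  by rewrite integral_tpow_left// subr0 -EFinM mulrC divfK// gt_eqF.
have Ig : (\int[mu]_z (g z)%:E = (tpow a (t - v))%:E)%E.
  rewrite /g ge0_integralZl_real ?(ltW a0)//; [|by meas|by nonneg].
  by rewrite integral_tpow_left// -EFinM mulrC divfK// gt_eqF.
(* On [w < z] the inner integral is [(z - v)^a]: this half is the term subtracted in [volterra]. *)
have T1 : (\int[mu]_z ((f z)%:E * \int[mu]_w (g w * tpow 0 (z - w))%:E) =
    (a * volterra_int a t v)%:E)%E.
  rewrite EFinM -volterra_intE// -ge0_integralZl_real; [|exact: ltW|by meas|by nonneg].
  apply: eq_integral => z _.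
  have [tz|zt] := lerP t z.
    by rewrite /f [tpow 0 _]tpow_le0 ?subr_le0// !mulr0 mul0e.
  transitivity ((f z)%:E * \int[mu]_w (a * (tpow (a - 1) (w - v) * tpow 0 (z - w)))%:E)%E.
    congr (_ * _)%E; apply: eq_integral => w _; congr (_%:E); rewrite /g.
    have [zw|wz] := lerP z w; first by rewrite ![tpow 0 (z - w)]tpow_le0 ?subr_le0// !mulr0.
    by rewrite [tpow 0 (t - w)]tpow0 ?mulr1 ?mulrA// subr_gt0 (lt_trans wz).
  rewrite ge0_integralZl_real; [|exact: ltW|by meas|by nonneg].
  rewrite integral_tpow_left// -!EFinM /f subr0; congr (_%:E); field; rewrite gt_eqF//.
(* On [z < w] the inner integral is [w^a]: this half is the required integral. *)
have T2 : (\int[mu]_w ((g w)%:E * \int[mu]_z (f z * tpow 0 (w - z))%:E) =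
    \int[mu]_z (a * (tpow a z * tpow (a - 1) (z - v) * tpow 0 (t - z)))%:E)%E.
  apply: eq_integral => w _.
  have [tw|wt] := lerP t w.
    by rewrite /g [tpow 0 _]tpow_le0 ?subr_le0// !mulr0 mul0e.
  transitivity ((g w)%:E * \int[mu]_z (a * (tpow (a - 1) (z - 0) * tpow 0 (w - z)))%:E)%E.
    congr (_ * _)%E; apply: eq_integral => z _; congr (_%:E); rewrite /f.
    have [zw|wz] := lerP w z; first by rewrite ![tpow 0 (w - z)]tpow_le0 ?subr_le0// !mulr0.
    by rewrite [tpow 0 (t - z)]tpow0 ?mulr1 ?mulrA// subr_gt0 (lt_trans wz).
  rewrite ge0_integralZl_real; [|exact: ltW|by meas|by nonneg].
  rewrite integral_tpow_left// -!EFinM /g subr0; congr (_%:E); field; rewrite gt_eqF//.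
have E := etrans (esym (ge0_integral_prod_split mf mg f0 g0)) (f_equal2 _ If Ig).
rewrite /volterra -!tpowE ?subr_gt0//; apply: addeIr_real.
by rewrite addeC; exact: (etrans (esym (f_equal2 adde T1 T2)) E).
Qed.

(** The constant that Feynman's formula yields, up to elementary factors, for either sign of [a]. It
    equals [2 H / d_H^2], see [fbm_const_sqr]. *)
Definition cov_coef a := G (1 + a) * G (1 - 2 * a) / G (1 - a).

(** A Beta integral over []v, +oo[], convergent at infinity because [a < 0]. Writing [z^(a-1)] as a
    Gamma integral and shifting by [v] separates the variables. *)
Lemma integral_tpow_mellin a v : -1 < a -> a < 0 -> 0 < v ->
  (\int[mu]_z (tpow (a - 1) z * tpow a (z - v))%:E
    = (G (1 + a) * G (- 2 * a) / G (1 - a) * tpow (2 * a) v)%:E)%E.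
Proof.
move=> aN1 a0 v0; have na0 : 0 < 1 - a by lra.
have a10 : 0 < 1 + a by lra.
have G0 := Gamma_gt0 na0.
set I := (X in X = _).
suff H : ((G (1 - a))%:E * I = (G (1 + a) * G (- 2 * a) * tpow (2 * a) v)%:E)%E.
  have -> : (I = ((G (1 - a))^-1)%:E * ((G (1 - a))%:E * I))%E.
    by rewrite muleA -EFinM mulVf ?mul1e// gt_eqF.
  rewrite H -EFinM; congr (_%:E); ring.
pose F z r := tpow a (z - v) * (tpow (1 - a - 1) r * expR (- (z * r))).
have mF : measurable_fun setT (fun x : R * R => (F x.1 x.2)%:E) by rewrite /F; meas.
transitivity (\int[mu]_z \int[mu]_r (F z r)%:E)%E.
  rewrite /I -ge0_integralZl_real; [|exact: ltW|by meas|by nonneg].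
  apply: eq_integral => z _.
  rewrite /F ge0_integralZl_real; [|by nonneg|by meas|by nonneg].
  have [zv|vz] := lerP z v.
    by rewrite [tpow _ (z - v)]tpow_le0 ?subr_le0// !(mulr0, mul0r, mul0e).
  have z0 : 0 < z by rewrite (lt_trans v0).
  rewrite integral_tpow_expR// -EFinM opprB; congr (_%:E); ring.
rewrite (ge0_integral_swap mF); last by nonneg.
transitivity (\int[mu]_r (G (1 + a) * (tpow (- 2 * a - 1) r * expR (- (v * r))))%:E)%E.
  apply: eq_integral => r _.
  have [r0|r0] := lerP r 0.
    by rewrite integral0_eq ?(tpow_le0 _ r0) ?(mul0r, mulr0)// => z _; rewrite /F (tpow_le0 _ r0) !(mul0r, mulr0).
  rewrite -(@ge0_integral_shift _ v); [|by rewrite /F; meas|by nonneg].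
  transitivity (\int[mu]_z (tpow (- a) r * expR (- (v * r)) * (tpow (1 + a - 1) z * expR (- (r * z))))%:E)%E.
    apply: eq_integral => z _; congr (_%:E); rewrite /F addrK.
    rewrite (_ : - ((z + v) * r) = - (v * r) + - (r * z)); last by ring.
    rewrite (_ : 1 + a - 1 = a); last by ring.
    rewrite (_ : 1 - a - 1 = - a); last by ring.
    rewrite expRD; ring.
  rewrite ge0_integralZl_real; [|by nonneg|by meas|by nonneg].
  rewrite integral_tpow_expR// -EFinM; congr (_%:E).
  rewrite (_ : - 2 * a - 1 = - a + - (1 + a)); last by ring.
  rewrite tpowD; ring.
rewrite ge0_integralZl_real; [|by apply/ltW/Gamma_gt0|by meas|by nonneg].
rewrite integral_tpow_expR//; last by lra.
by rewrite -EFinM mulrA (_ : - (- 2 * a) = 2 * a)//; ring.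
Qed.

(** Elimination of the tail [x2] between two linear relations; the second one forces [x2] to be
    finite, the first one then [x1]. *)
Lemma adde_combine (x1 x2 : \bar R) (b m p q j : R) :
  (x1 + b%:E * x2 = p%:E * q%:E -> j%:E + x2 = m%:E ->
   x1 + b%:E * m%:E = (p * q + b * j)%:E)%E.
Proof.
case: x2 => [x2| |]//=; case: x1 => [x1| |]//= [E] [<-].
by congr (_%:E); rewrite -E; ring.
Qed.

(** For [a < 0] the powers [t^a] and [(t - v)^a] are integrals over []t, +oo[], away from the
    singularity at [v]. Splitting their product leaves a tail of the integrand of [volterra_int];
    together with [volterra_int] it makes up the full integral [integral_tpow_mellin], whence the
    term in [v^(2a)]. *)
Lemma volterra_neg a t v : - 2^-1 < a -> a < 0 -> 0 < v -> v < t ->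
  (\int[mu]_z ((- a) * (tpow a z * tpow (a - 1) (z - v) * tpow 0 (z - t)))%:E
    + (cov_coef a / 2 * tpow (2 * a) v)%:E = (volterra a t v)%:E)%E.
Proof.
move=> aN1 a0 v0 vt; have t0 : 0 < t by rewrite (lt_trans v0).
have b0 : 0 < - a by lra.
pose f z := - a * (tpow 0 (z - t) * tpow (a - 1) z).
pose g w := - a * (tpow 0 (w - t) * tpow (a - 1) (w - v)).
have f0 z : 0 <= f z by nonneg.
have g0 z : 0 <= g z by nonneg.
have mf : measurable_fun setT f by rewrite /f; meas.
have mg : measurable_fun setT g by rewrite /g; meas.
have If : (\int[mu]_z (f z)%:E = (tpow a t)%:E)%E.
  rewrite /f ge0_integralZl_real ?(ltW b0)//; [|by meas|by nonneg].
  by rewrite integral_tpow_right// -EFinM mulrC divfK// gt_eqF.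
have Ig : (\int[mu]_z (g z)%:E = (tpow a (t - v))%:E)%E.
  rewrite /g ge0_integralZl_real ?(ltW b0)//; [|by meas|by nonneg].
  by rewrite integral_tpow_rightD// -EFinM mulrC divfK// gt_eqF.
have T1 : (\int[mu]_w ((g w)%:E * \int[mu]_z (f z * tpow 0 (z - w))%:E) =
    \int[mu]_z (- a * (tpow a z * tpow (a - 1) (z - v) * tpow 0 (z - t)))%:E)%E.
  apply: eq_integral => w _.
  have [wt|tw] := lerP w t.
    by rewrite /g [tpow 0 _]tpow_le0 ?subr_le0// !(mulr0, mul0r) mul0e.
  transitivity ((g w)%:E * \int[mu]_z (- a * (tpow 0 (z - w) * tpow (a - 1) z))%:E)%E.
    congr (_ * _)%E; apply: eq_integral => z _; congr (_%:E); rewrite /f.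
    have [zw|wz] := lerP z w; first by rewrite ![tpow 0 (z - w)]tpow_le0 ?subr_le0// !(mulr0, mul0r).
    by rewrite [tpow 0 (z - t)]tpow0 ?subr_gt0 ?(lt_trans tw)//; ring.
  rewrite ge0_integralZl_real; [|exact: ltW|by meas|by nonneg].
  rewrite integral_tpow_right//; last by rewrite (lt_trans t0).
  rewrite -!EFinM /g; congr (_%:E); field; lra.
(* This half of the split is [- a] times the tail over [z > t]. *)
have T2 : (\int[mu]_z ((f z)%:E * \int[mu]_w (g w * tpow 0 (w - z))%:E) =
    (- a)%:E * \int[mu]_z (tpow (a - 1) z * tpow a (z - v) * tpow 0 (z - t))%:E)%E.
  rewrite -ge0_integralZl_real; [|exact: ltW|by meas|by nonneg].
  apply: eq_integral => z _.
  have [zt|tz] := lerP z t.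
    by rewrite /f [tpow 0 _]tpow_le0 ?subr_le0// !(mulr0, mul0r) mul0e.
  transitivity ((f z)%:E * \int[mu]_w (- a * (tpow 0 (w - z) * tpow (a - 1) (w - v)))%:E)%E.
    congr (_ * _)%E; apply: eq_integral => w _; congr (_%:E); rewrite /g.
    have [wz|zw] := lerP w z; first by rewrite ![tpow 0 (w - z)]tpow_le0 ?subr_le0// !(mulr0, mul0r).
    by rewrite [tpow 0 (w - t)]tpow0 ?subr_gt0 ?(lt_trans tz)//; ring.
  rewrite ge0_integralZl_real; [|exact: ltW|by meas|by nonneg].
  rewrite integral_tpow_rightD//; last by rewrite (lt_trans vt).
  rewrite -!EFinM /f; congr (_%:E); field; lra.
have aN : -1 < a by lra.
have a1 : a < 1 by lra.
pose k z := tpow (a - 1) z * tpow a (z - v).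
have mk : measurable_fun setT k by rewrite /k; meas.
have k0 z : 0 <= k z by nonneg.
(* [E1]: the wanted integral plus [- a] times the tail is [t^a (t - v)^a]. [E2]: [volterra_int] plus
   the tail is the full integral. Eliminating the tail gives the claim. *)
have E1 := etrans (f_equal2 adde
  (etrans (esym T1) (ge0_integral_swap_half mg mf g0 f0))
  (etrans (esym T2) (ge0_integral_swap_half mf mg f0 g0)))
  (etrans (esym (ge0_integral_prod_split mf mg f0 g0)) (f_equal2 mule If Ig)).
have E2 := etrans (etrans (f_equal2 adde (esym (volterra_intE t aN a1 v0)) erefl)
  (esym (ge0_integral_split t mk k0))) (integral_tpow_mellin aN a0 v0).
have G0 : G (1 - a) != 0 by rewrite gt_eqF// Gamma_gt0//; lra.
(* By [Gamma (1 - 2a) = - 2a Gamma (- 2a)]. *)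
have cE : cov_coef a / 2 * tpow (2 * a) v = - a * (G (1 + a) * G (- 2 * a) / G (1 - a) * tpow (2 * a) v).
  rewrite /cov_coef (_ : 1 - 2 * a = - 2 * a + 1); last by ring.
  rewrite GammaS; last by lra.
  move: G0; move: (G (1 + a)) (G (- 2 * a)) (G (1 - a)) (tpow _ _) => g1 g2 g3 x G0.
  by field.
rewrite cE EFinM /volterra -!tpowE ?subr_gt0// -mulNr.
exact: (adde_combine E1 E2).
Qed.

End VolterraKernel.

(** * Tonelli for triple integrals, and the double integral of a power of the distance *)

Section TonelliRotation.
Variable R : realType.
Implicit Types (a b c d p q r s t u v w x y : R).
Local Notation mu := (@lebesgue_measure R).
Local Notation G := (@Gamma R).

(** Brings the integration over [v] innermost, where Feynman's formula evaluates it. *)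
Lemma ge0_integral_rotate (Q : R -> R -> R -> R) :
  measurable_fun setT (fun x : (R * R) * R => (Q x.1.1 x.1.2 x.2)%:E) ->
  (forall z, measurable_fun setT (fun x : R * R => (Q x.1 z x.2)%:E)) ->
  (forall x y z, 0 <= Q x y z) ->
  (\int[mu]_v \int[mu]_z \int[mu]_w (Q v z w)%:E =
   \int[mu]_z \int[mu]_w \int[mu]_v (Q v z w)%:E)%E.
Proof.
move=> mQ mQz Q0.
have mh : measurable_fun setT (fun x : R * R => \int[mu]_w (Q x.1 x.2 w)%:E)%E.
  apply: (@measurable_fun_fubini_tonelli_F _ _ _ _ _ mu
    (fun x : (R * R) * R => (Q x.1.1 x.1.2 x.2)%:E) mQ).
  by move=> x; rewrite lee_fin.
rewrite (ge0_integral_swap mh); last by move=> x y; apply: integral_ge0 => w _; rewrite lee_fin.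
apply: eq_integral => z _.
by rewrite (ge0_integral_swap (mQz z))// => x y; rewrite lee_fin.
Qed.

Lemma ge0_integralZr_real c (f : R -> R) : 0 <= c ->
  measurable_fun setT f -> (forall x, 0 <= f x) ->
  (\int[mu]_x (f x * c)%:E = \int[mu]_x (f x)%:E * c%:E)%E.
Proof.
move=> c0 mf f0; rewrite muleC -ge0_integralZl_real//.
by apply: eq_integral => x _; rewrite mulrC.
Qed.

Lemma ge0_integral2Zl c (F : R -> R -> R) : 0 <= c ->
  measurable_fun setT (fun x : R * R => F x.1 x.2) ->
  (forall x, measurable_fun setT (F x)) -> (forall x y, 0 <= F x y) ->
  (\int[mu]_x \int[mu]_y (c * F x y)%:E = c%:E * \int[mu]_x \int[mu]_y (F x y)%:E)%E.
Proof.
move=> c0 mF mFx F0; rewrite -ge0_integralZl//.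
- by apply: eq_integral => x _; exact: ge0_integralZl_real.
- apply: (@measurable_integral_fst R (fun x y => (F x y)%:E)).
    exact: measurable_EFin_comp.
  by move=> x y; rewrite lee_fin.
- by move=> x _; apply: integral_ge0 => y _; rewrite lee_fin.
Qed.

(** Off the diagonal the sum of truncated powers is [|z - w|^(c-1)]. With [c = 2 H - 1] this is, up
    to a factor, the classical double integral for the covariance when [H > 1/2]. *)
Lemma integral_square_power c s t : 0 < c -> 0 < s -> s <= t ->
  (\int[mu]_z \int[mu]_w (tpow 0 z * tpow 0 w * (tpow 0 (t - z) * tpow 0 (s - w))
      * (tpow (c - 1) (w - z) + tpow (c - 1) (z - w)))%:E
   = ((tpow (c + 1) s + tpow (c + 1) t - tpow (c + 1) (t - s)) / (c * (c + 1)))%:E)%E.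
Proof.
move=> c0 s0 st; have c10 : 0 < c + 1 by rewrite addr_gt0.
(* The halves [z < w] and [w < z]. On [0 < z < w < s] both [0 < w] and [z < t] follow, the latter
   from [s <= t]; on [0 < w < z] so does [0 < z]. Only the remaining indicators are kept. *)
pose N1 z w := tpow 0 z * (tpow (c - 1) (w - z) * tpow 0 (s - w)).
pose N2 z w := tpow 0 w * tpow 0 (s - w) * (tpow (c - 1) (z - w) * tpow 0 (t - z)).
have m1 : measurable_fun setT (fun x : R * R => (N1 x.1 x.2)%:E) by rewrite /N1; meas.
have m2 : measurable_fun setT (fun x : R * R => (N2 x.1 x.2)%:E) by rewrite /N2; meas.
have N10 z w : 0 <= N1 z w by nonneg.
have N20 z w : 0 <= N2 z w by nonneg.
transitivity (\int[mu]_z (\int[mu]_w (N1 z w)%:E + \int[mu]_w (N2 z w)%:E))%E.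
  apply: eq_integral => z _.
  rewrite -ge0_integralD_real//; [|by rewrite /N1; meas|by rewrite /N2; meas].
  apply: eq_integral => w _; congr (_%:E); rewrite mulrDr; congr (_ + _).
    have [z0|z0] := lerP z 0; first by rewrite /N1 (tpow_le0 _ z0) !mul0r.
    have [wz|zw] := lerP w z; first by rewrite /N1 [tpow _ (w - z)]tpow_le0 ?subr_le0// !(mul0r, mulr0).
    have [sw|ws] := lerP s w; first by rewrite /N1 [tpow _ (s - w)]tpow_le0 ?subr_le0// !(mul0r, mulr0).
    rewrite /N1 [tpow 0 w]tpow0 ?(lt_trans z0)// [tpow 0 (t - z)]tpow0; first by ring.
    by rewrite subr_gt0 (lt_trans zw)// (lt_le_trans ws).
  have [w0|w0] := lerP w 0; first by rewrite /N2 (tpow_le0 _ w0) !(mul0r, mulr0).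
  have [zw|wz] := lerP z w; first by rewrite /N2 [tpow _ (z - w)]tpow_le0 ?subr_le0// !(mul0r, mulr0).
  rewrite /N2 [tpow 0 z]tpow0 ?(lt_trans w0)//; ring.
rewrite ge0_integralD//; first last.
- by apply: (measurable_integral_fst m2); nonneg.
- by move=> z _; apply: integral_ge0; nonneg.
- by apply: (measurable_integral_fst m1); nonneg.
- by move=> z _; apply: integral_ge0; nonneg.
have I1 : (\int[mu]_z \int[mu]_w (N1 z w)%:E = (tpow (c + 1) s / (c * (c + 1)))%:E)%E.
  transitivity (\int[mu]_z (c^-1 * (tpow (c + 1 - 1) (s - z) * tpow 0 (z - 0)))%:E)%E.
    apply: eq_integral => z _; rewrite /N1 ge0_integralZl_real; [|by nonneg|by meas|by nonneg].
    rewrite (integral_tpow_left z s c0) -EFinM; congr (_%:E).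
    by rewrite addrK subr0; ring.
  rewrite ge0_integralZl_real; [|by rewrite invr_ge0 ltW|by meas|by nonneg].
  rewrite (integral_tpow_leftN 0 s c10) -EFinM subr0; congr (_%:E).
  by rewrite invfM; ring.
have I2 : (\int[mu]_z \int[mu]_w (N2 z w)%:E = ((tpow (c + 1) t - tpow (c + 1) (t - s)) / (c * (c + 1)))%:E)%E.
  rewrite (ge0_integral_swap m2); last by nonneg.
  transitivity (\int[mu]_w (c^-1 * (tpow 0 (w - 0) * tpow 0 (s - w) * tpow (c + 1 - 1) (t - w)))%:E)%E.
    apply: eq_integral => w _; rewrite /N2 ge0_integralZl_real; [|by nonneg|by meas|by nonneg].
    rewrite (integral_tpow_left w t c0) -EFinM; congr (_%:E).
    by rewrite addrK subr0; ring.
  rewrite ge0_integralZl_real; [|by rewrite invr_ge0 ltW|by meas|by nonneg].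
  rewrite (integral_tpow_diff c10 (ltW s0) st) -EFinM subr0; congr (_%:E).
  by rewrite invfM; ring.
apply: (etrans (f_equal2 adde I1 I2)); rewrite -[LHS]EFinD; congr (_%:E).
by rewrite -mulrDl addrA.
Qed.

End TonelliRotation.

(** * The covariance identity for [a > 0] *)

Section CovariancePositive.
Variable R : realType.
Implicit Types (a b c d p q r s t u v w x y : R).
Local Notation mu := (@lebesgue_measure R).
Local Notation G := (@Gamma R).

(** The weights [z^a w^a] of the two kernels cancel the powers produced by Feynman's formula, so
    that only [|z - w|^(2a-1)] is left for [integral_square_power]. *)
Lemma volterra_cov_pos a s t : 0 < a -> a < 2^-1 -> 0 < s -> s <= t ->
  (\int[mu]_v (tpow (- 2 * a) v * tpow 0 (s - v) * (volterra a t v * volterra a s v))%:E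
   = (cov_coef a / 2 / (2 * a + 1) *
      (tpow (2 * a + 1) s + tpow (2 * a + 1) t - tpow (2 * a + 1) (t - s)))%:E)%E.
Proof.
move=> a0 a2 s0 st; have a1 : a < 1 by lra.
pose k r v z := a * (tpow a z * tpow (a - 1) (z - v) * tpow 0 (r - z)).
have k0 r v z : 0 <= k r v z by nonneg.
pose Q v z w := tpow (- 2 * a) v * (k t v z * k s v w).
have Q0 v z w : 0 <= Q v z w by nonneg.
have m11 : measurable_fun setT (fun x : (R * R) * R => x.1.1).
  exact: (measurableT_comp measurable_fst measurable_fst).
have m12 : measurable_fun setT (fun x : (R * R) * R => x.1.2).
  exact: (measurableT_comp measurable_snd measurable_fst).
have mQ : measurable_fun setT (fun x : (R * R) * R => (Q x.1.1 x.1.2 x.2)%:E).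
  by rewrite /Q /k; meas.
have mQz z : measurable_fun setT (fun x : R * R => (Q x.1 z x.2)%:E).
  by rewrite /Q /k; meas.
have mQz' z : measurable_fun setT (fun x : R * R => (Q x.2 z x.1)%:E).
  by rewrite /Q /k; meas.
transitivity (\int[mu]_v \int[mu]_z \int[mu]_w (Q v z w)%:E)%E.
  apply: eq_integral => v _.
  have [v0|v0] := lerP v 0.
    rewrite (tpow_le0 _ v0) !mul0r integral0_eq// => z _.
    by rewrite integral0_eq// => w _; rewrite /Q (tpow_le0 _ v0) !mul0r.
  (* For [v >= s] the triple integral vanishes too, as no [w] satisfies [v < w < s]. *)
  have [sv|vs] := lerP s v.
    rewrite [tpow 0 _]tpow_le0 ?subr_le0// mulr0 mul0r integral0_eq// => z _.
    rewrite integral0_eq// => w _; rewrite /Q /k.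
    have [wv|vw] := lerP w v; first by rewrite [tpow _ (w - v)]tpow_le0 ?subr_le0// !(mul0r, mulr0).
    by rewrite [tpow _ (s - w)]tpow_le0 ?subr_le0 ?(le_trans sv) ?ltW// !(mul0r, mulr0).
  have vt := lt_le_trans vs st.
  have Es := volterra_pos a0 a1 v0 vs; have Et := volterra_pos a0 a1 v0 vt.
  have vol0 : 0 <= volterra a s v.
    by rewrite -lee_fin -Es; apply: integral_ge0; nonneg.
  transitivity (\int[mu]_z (tpow (- 2 * a) v * volterra a s v * k t v z)%:E)%E.
    rewrite ge0_integralZl_real; [|by nonneg|by rewrite /k; meas|by nonneg].
    rewrite Et -EFinM [tpow 0 _]tpow0 ?subr_gt0//; congr (_%:E); ring.
  apply: eq_integral => z _.
  transitivity (\int[mu]_w (tpow (- 2 * a) v * k t v z * k s v w)%:E)%E.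
    rewrite ge0_integralZl_real; [|by nonneg|by rewrite /k; meas|by nonneg].
    by rewrite Es -EFinM; congr (_%:E); rewrite mulrAC.
  by apply: eq_integral => w _; rewrite /Q mulrA.
rewrite (ge0_integral_rotate mQ mQz Q0).
pose N z w := tpow 0 z * tpow 0 w * (tpow 0 (t - z) * tpow 0 (s - w))
      * (tpow (2 * a - 1) (w - z) + tpow (2 * a - 1) (z - w)).
have N0 z w : 0 <= N z w by nonneg.
have mN : measurable_fun setT (fun x : R * R => N x.1 x.2) by rewrite /N; meas.
have mNz z : measurable_fun setT (fun w => N z w) by rewrite /N; meas.
pose C := a * cov_coef a.
have p0 : 0 < 1 - 2 * a by lra.
have A0 : 0 <= cov_coef a.
  by rewrite /cov_coef divr_ge0 ?mulr_ge0//; apply/ltW/Gamma_gt0; lra.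
have C0 : 0 <= C by rewrite /C mulr_ge0// ltW.
have CE : a * a * (G (1 - 2 * a) * G a / G (1 - 2 * a + a)) = C.
  rewrite /C /cov_coef (_ : 1 - 2 * a + a = 1 - a); last by ring.
  have -> : G (1 + a) = a * G a by rewrite [1 + a]addrC; exact: GammaS.
  move: (G (1 - 2 * a)) (G a) (G (1 - a)) => g1 g2 g3; ring.
(* Feynman's formula with exponents [1 - 2a] and [a], whose sum [1 - a] is exactly what the factor
   [(w - v)^(a-1)] demands. *)
have key z w : z < w ->
    (\int[mu]_v (tpow (- 2 * a) v * (tpow (a - 1) (z - v) * tpow (a - 1) (w - v)))%:E
     * (a * a * (tpow a z * tpow a w))%:E =
     (C * (tpow 0 z * tpow 0 w * tpow (2 * a - 1) (w - z)))%:E)%E.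
  move=> zw; have [z0|z0] := lerP z 0.
    by rewrite !(tpow_le0 _ z0) !(mul0r, mulr0) mule0.
  have w0 := lt_trans z0 zw.
  have -> : (\int[mu]_v (tpow (- 2 * a) v * (tpow (a - 1) (z - v) * tpow (a - 1) (w - v)))%:E =
    \int[mu]_v (tpow (1 - 2 * a - 1) v * tpow (a - 1) (z - v) * tpow (- (1 - 2 * a + a)) (w - v))%:E)%E.
    apply: eq_integral => v _; rewrite mulrA (_ : 1 - 2 * a - 1 = - 2 * a); last by ring.
    by rewrite (_ : - (1 - 2 * a + a) = a - 1)//; ring.
  rewrite (integral_feynman p0 a0 z0 zw) -EFinM -CE; congr (_%:E).
  move: (G (1 - 2 * a) * G a / G (1 - 2 * a + a)) => g.
  rewrite (_ : 1 - 2 * a + a - 1 = - a); last by ring.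
  rewrite (_ : - (1 - 2 * a) = 2 * a - 1); last by ring.
  rewrite (tpowV a z0) (tpowV a w0) (tpow0 z0) (tpow0 w0).
  have := lt0r_neq0 (tpow_gt0 a z0); have := lt0r_neq0 (tpow_gt0 a w0).
  move: (tpow a z) (tpow a w) (tpow _ _) => x y r y0 x0.
  by field; rewrite x0 y0.
have QN z w : w != z -> (\int[mu]_v (Q v z w)%:E = (C * N z w)%:E)%E.
  move=> wz.
  transitivity (\int[mu]_v (tpow (- 2 * a) v * (tpow (a - 1) (z - v) * tpow (a - 1) (w - v)))%:E
     * (a * a * (tpow a z * tpow a w) * (tpow 0 (t - z) * tpow 0 (s - w)))%:E)%E.
    have c0 : 0 <= a * a * (tpow a z * tpow a w) * (tpow 0 (t - z) * tpow 0 (s - w)) by nonneg.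
    have f0 v : 0 <= tpow (- 2 * a) v * (tpow (a - 1) (z - v) * tpow (a - 1) (w - v)) by nonneg.
    have mf : measurable_fun setT (fun v => tpow (- 2 * a) v * (tpow (a - 1) (z - v) * tpow (a - 1) (w - v))) by meas.
    apply: esym; apply: (etrans (esym (ge0_integralZr_real c0 mf f0))).
    by apply: eq_integral => v _; congr (_%:E); rewrite /Q /k; ring.
  rewrite EFinM muleA; have [zw|wz'] := ltP z w.
    rewrite (key _ _ zw) -EFinM /N [tpow _ (z - w)]tpow_le0 ?subr_le0 ?ltW//.
    by congr (_%:E); rewrite addr0; ring.
  have {wz'} wz' : w < z by rewrite lt_neqAle wz.
  have := key _ _ wz'; rewrite [tpow a w * _]mulrC => H.
  under eq_integral => v _ do rewrite [tpow (a - 1) _ * _]mulrC.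
  rewrite H -EFinM /N [tpow _ (w - z)]tpow_le0 ?subr_le0 ?ltW//.
  by congr (_%:E); rewrite add0r; ring.
(* The integral over [v] may diverge when [w = z]; for each [z] this is a single point. *)
transitivity (\int[mu]_z \int[mu]_w (C * N z w)%:E)%E.
  apply: eq_integral => z _; apply: (@eq_integral_neq R z).
  - apply: (@measurable_integral_fst R (fun w v => (Q v z w)%:E) (mQz' z)).
    by move=> w v; rewrite lee_fin.
  - by apply: measurable_EFin_comp; apply: measurable_funM.
  - by move=> w; exact: QN.
transitivity (C%:E * \int[mu]_z \int[mu]_w (N z w)%:E)%E.
  exact: (ge0_integral2Zl C0 mN mNz N0).
have a20 : 0 < 2 * a by lra.
rewrite (integral_square_power a20 s0 st) -EFinM /C; congr (_%:E).
by field; lra.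
Qed.

End CovariancePositive.

(** * The covariance identity for [a < 0] *)

Section CovarianceNegative.
Variable R : realType.
Implicit Types (a b c d p q r s t u v w x y : R).
Local Notation mu := (@lebesgue_measure R).
Local Notation G := (@Gamma R).

Lemma powR_pred p x : 0 < x -> x `^ p = x * x `^ (p - 1).
Proof.
move=> x0; rewrite -{2}[x]powRr1 ?ltW// -powRD; first by rewrite addrC subrK.
by rewrite (@gt_eqF _ _ x)// implybT.
Qed.

(** The boundary term at infinity in [integral_shift_diff]. For [x > 2 s] one has
    [(x - s)^(2a) <= (x / 2)^(2a)], which leaves the bound [2^(-2a) x^a]. *)
Lemma powR_shift_diff_cvg0 a s : - 2^-1 < a -> a < 0 -> 0 < s ->
  (x `^ (- a) * ((x - s) `^ (2 * a) - x `^ (2 * a)) : R) @[x --> +oo] --> (0 : R).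
Proof.
move=> aN a0 s0.
have big : \forall x \near +oo, 2 * s < x by apply: nbhs_pinfty_gt; exact: num_real.
have na20 : 0 <= - (2 * a) by lra.
apply: (@squeeze_cvgr _ _ _ _ (fun=> 0) (fun x => 2 `^ (- (2 * a)) * x `^ a)).
- near=> x; have xs : 2 * s < x by near: x.
  have x0 : 0 < x by lra.
  have xs0 : 0 < x - s by lra.
  have xpow : x `^ a = x `^ (- a) * x `^ (2 * a).
    by rewrite -powRD ?(@gt_eqF _ _ x) ?implybT//; congr (_ `^ _); ring.
  have d0 : x `^ (2 * a) <= (x - s) `^ (2 * a).
    rewrite -[2 * a]opprK ![_ `^ (- - _)]powRN lef_pV2 ?posrE ?powR_gt0//.
    by rewrite ge0_ler_powR ?nnegrE//; lra.
  apply/andP; split; first by rewrite mulr_ge0 ?powR_ge0// subr_ge0.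
  rewrite xpow mulrCA ler_wpM2l ?powR_ge0//.
  apply: (@le_trans _ _ ((x - s) `^ (2 * a))); first by rewrite gerBl powR_ge0.
  have -> : 2 `^ (- (2 * a)) * x `^ (2 * a) = (2^-1 * x) `^ (2 * a).
    by rewrite powRM ?ltW// -powR_inv1// -powRrM mulN1r.
  rewrite -[2 * a]opprK ![_ `^ (- - _)]powRN lef_pV2 ?posrE ?powR_gt0//; last by lra.
  by rewrite ge0_ler_powR ?nnegrE//; lra.
- exact: cvg_cst.
- by rewrite -[X in _ --> X](mulr0 (2 `^ (- (2 * a)))); apply: cvgMr; exact: powR_cvgy0.
Unshelve. all: by end_near. Qed.

(* The integrand has the antiderivative [x^(-a) ((x - s)^(2a) - x^(2a)) / (2a)]. *)
Lemma integral_shift_diff a s tau : - 2^-1 < a -> a < 0 -> 0 < s -> s < tau ->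
  (\int[mu]_x (tpow 0 (x - tau) * (tpow (- 1 - a) x *
      (s * tpow (2 * a - 1) (x - s) + (tpow (2 * a) (x - s) - tpow (2 * a) x) / 2)))%:E
   = (tpow (- a) tau * (tpow (2 * a) (tau - s) - tpow (2 * a) tau) / (2 * - a))%:E)%E.
Proof.
move=> aN a0 s0 stau; have tau0 := lt_trans s0 stau.
pose f x := x `^ (- 1 - a) *
  (s * (x - s) `^ (2 * a - 1) + ((x - s) `^ (2 * a) - x `^ (2 * a)) / 2).
pose F x := (2 * a)^-1 * (x `^ (- a) * ((x - s) `^ (2 * a) - x `^ (2 * a))).
have dB x : is_derive x 1 (fun x => x - s) 1.
  by rewrite -[X in is_derive _ _ _ X]addr0; apply: is_deriveD.
have dS p x : s < x -> is_derive x 1 (fun x => (x - s) `^ p) (p * (x - s) `^ (p - 1)).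
  move=> sx; have xs0 : 0 < x - s by rewrite subr_gt0.
  have := @is_derive1_comp R (@powR R ^~ p) (fun x => x - s) x _ _ (@is_derive1_powR R p _ xs0) (dB x).
  by rewrite mulr1.
have dP p x : s < x -> is_derive x 1 (@powR R ^~ p) (p * x `^ (p - 1)).
  by move=> sx; apply: is_derive1_powR; rewrite (lt_trans s0).
have dF x : s < x -> is_derive x 1 F (f x).
  move=> sx; have x0 := lt_trans s0 sx; have xs0 : 0 < x - s by rewrite subr_gt0.
  have D := is_deriveZ (2 * a)^-1 (is_deriveM (dP (- a) x sx)
    (is_deriveB (dS (2 * a) x sx) (dP (2 * a) x sx))).
  have -> : f x = (2 * a)^-1 *: (x `^ (- a) *: (2 * a * (x - s) `^ (2 * a - 1) - 2 * a * x `^ (2 * a - 1))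
      + ((x - s) `^ (2 * a) - x `^ (2 * a)) *: (- a * x `^ (- a - 1))).
    rewrite /GRing.scale /= /f (powR_pred (- a) x0) (powR_pred (2 * a) x0) (powR_pred (2 * a) xs0).
    rewrite (_ : - 1 - a = - a - 1); last by ring.
    move: (x `^ _) (x `^ _) ((x - s) `^ _) => y1 y2 y3.
    by field; lra.
  exact: D.
have cF x : s < x -> {for x, continuous F}.
  move=> sx; apply: differentiable_continuous; apply/derivable1_diffP.
  by have [] := dF _ sx.
have cpow (g : R -> R) dg x : is_derive x (1:R) g dg -> {for x, continuous g}.
  by move=> [] /derivable1_diffP /differentiable_continuous.
have cf x : s < x -> {for x, continuous f}.
  move=> sx; apply: continuousM; first exact: cpow (dP _ _ sx).
  apply: continuousD.
    by apply: continuousM; [exact: cst_continuous|exact: cpow (dS _ _ sx)].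
  apply: continuousM; last exact: cst_continuous.
  by apply: continuousB; [exact: cpow (dS _ _ sx)|exact: cpow (dP _ _ sx)].
transitivity (\int[mu]_(x in `[tau, +oo[) (f x)%:E)%E.
  rewrite -integral_itv_obnd_cbnd; last first.
    apply/measurable_EFinP; apply: open_continuous_measurable_fun => // x.
    by rewrite inE/= in_itv/= andbT => /(lt_trans stau); exact: cf.
  apply/esym/integral_restrictE => x /=; rewrite in_itv/= andbT.
    move=> tx; have sx := lt_trans stau tx.
    by rewrite tpow0 ?subr_gt0// mul1r !tpowE ?subr_gt0// (lt_trans s0).
  by move=> /negP; rewrite -leNgt => xt; rewrite tpow_le0 ?subr_le0// mul0r.
rewrite (@ge0_continuous_FTC2y _ f F tau 0).
- rewrite sub0e -EFinN !tpowE ?subr_gt0//; congr (_%:E).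
  by rewrite /F; field; lra.
- move=> x tx; have sx := lt_le_trans stau tx; have x0 := lt_trans s0 sx.
  have xs0 : 0 < x - s by rewrite subr_gt0.
  rewrite mulr_ge0 ?powR_ge0// addr_ge0 ?mulr_ge0 ?powR_ge0 ?(ltW s0)//.
  rewrite subr_ge0.
  rewrite -[2 * a]opprK ![_ `^ (- - _)]powRN lef_pV2 ?posrE ?powR_gt0//.
  by rewrite ge0_ler_powR ?nnegrE//; lra.
- apply/continuous_within_itvcyP; split.
    by move=> x; rewrite in_itv/= andbT => /(lt_trans stau); exact: cf.
  by apply: cvg_at_right_filter; exact: cf.
- by rewrite -[X in _ --> X](mulr0 (2 * a)^-1); apply: cvgMr; exact: powR_shift_diff_cvg0.
- by move=> x tx; have [] := dF _ (lt_trans stau tx).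
- by apply: cvg_at_right_filter; exact: cF.
- move=> x; rewrite in_itv/= andbT => tx; rewrite derive1E.
  by have [] := dF _ (lt_trans stau tx).
Qed.

(* Writing [(tau - v)^(a - 1)] as an integral of [(x - v)^(a - 2)] over [x > tau]
   balances the exponents as [integral_feynman] requires. *)
Lemma integral_tpow_triple a z tau : - 2^-1 < a -> a < 0 -> 0 < z -> z < tau ->
  (\int[mu]_v (tpow (- 2 * a) v * tpow (a - 1) (tau - v) * tpow a (z - v))%:E =
   \int[mu]_x (cov_coef a * (tpow (1 - a) z * tpow (2 * a - 1) (x - z) * tpow (- 1 - a) x
      * tpow 0 (x - tau)))%:E)%E.
Proof.
move=> aN a0 z0 ztau.
have p0 : 0 < 1 - 2 * a by lra.
have q0 : 0 < 1 + a by lra.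
have na10 : 0 < 1 - a by lra.
have a10 : a - 1 < 0 by lra.
have G0 : G (1 - a) != 0 by rewrite gt_eqF// Gamma_gt0.
have A0 : 0 <= cov_coef a.
  by rewrite /cov_coef divr_ge0 ?mulr_ge0//; apply/ltW/Gamma_gt0.
(* The factor [1 - a] normalises the integral of [(x - v)^(a-2)] and cancels against
   [Gamma (2 - a) = (1 - a) Gamma (1 - a)]. *)
have AE : (1 - a) * (G (1 - 2 * a) * G (1 + a) / G (1 - 2 * a + (1 + a))) = cov_coef a.
  rewrite /cov_coef (_ : 1 - 2 * a + (1 + a) = (1 - a) + 1); last by ring.
  have -> : G (1 - a + 1) = (1 - a) * G (1 - a) by exact: GammaS.
  move: G0; move: (G (1 - 2 * a)) (G (1 + a)) (G (1 - a)) => g1 g2 g3 g30.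
  by field; rewrite g30; lra.
pose F v x := (1 - a) * (tpow (- 2 * a) v * tpow a (z - v)) * (tpow 0 (x - tau) * tpow (a - 1 - 1) (x - v)).
have mF : measurable_fun setT (fun x : R * R => (F x.1 x.2)%:E) by rewrite /F; meas.
transitivity (\int[mu]_v \int[mu]_x (F v x)%:E)%E.
  apply: eq_integral => v _.
  rewrite /F ge0_integralZl_real; [|by nonneg|by meas|by nonneg].
  have [zv|vz] := lerP z v.
    by rewrite [tpow _ (z - v)]tpow_le0 ?subr_le0// !(mulr0, mul0r, mul0e).
  rewrite (integral_tpow_rightD a10 (lt_trans vz ztau)) -EFinM; congr (_%:E).
  by field; lra.
rewrite (ge0_integral_swap mF); last by nonneg.
apply: eq_integral => x _.
have [xt|tx] := lerP x tau.
  rewrite [tpow 0 _]tpow_le0 ?subr_le0// !mulr0 integral0_eq// => v _.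
  by rewrite /F [tpow 0 _]tpow_le0 ?subr_le0// !(mulr0, mul0r).
have zx := lt_trans ztau tx; have x0 := lt_trans z0 zx.
transitivity (\int[mu]_v ((1 - a) * (tpow (1 - 2 * a - 1) v * tpow (1 + a - 1) (z - v) * tpow (- (1 - 2 * a + (1 + a))) (x - v)))%:E)%E.
  apply: eq_integral => v _; rewrite /F [tpow 0 _]tpow0 ?subr_gt0//.
  rewrite (_ : 1 - 2 * a - 1 = - 2 * a); last by ring.
  rewrite (_ : 1 + a - 1 = a); last by ring.
  rewrite (_ : - (1 - 2 * a + (1 + a)) = a - 1 - 1); last by ring.
  by congr (_%:E); ring.
rewrite ge0_integralZl_real; [|exact: ltW|by meas|by nonneg].
rewrite (integral_feynman p0 q0 z0 zx) -EFinM; congr (_%:E).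
rewrite [LHS]mulrA AE [tpow 0 _]tpow0 ?subr_gt0// mulr1.
rewrite (_ : 1 - 2 * a + (1 + a) - 1 = 1 - a); last by ring.
rewrite (_ : - (1 - 2 * a) = 2 * a - 1); last by ring.
by rewrite (_ : - (1 + a) = -1 - a)//; ring.
Qed.


(** For [a < 0] the definition of [volterra] has two nonnegative terms. The alternative [k = 0]
    covers [v <= 0], where [volterra] is meaningless but the weights in use vanish. *)
Lemma volterra_intM a s v (k : R) : -1 < a -> a < 0 -> 0 <= k -> (0 < v \/ k = 0) ->
  ((k * (tpow 0 (s - v) * volterra a s v))%:E =
   (k * (tpow a s * tpow a (s - v)))%:E
   + \int[mu]_z (k * (- a * (tpow (a - 1) z * tpow a (z - v) * tpow 0 (s - z))))%:E)%E.
Proof.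
move=> aN a0 k0 [v0|->]; last first.
  rewrite integral0_eq ?mul0r ?adde0// => z _; by rewrite mul0r.
have a1 : a < 1 by lra.
have na0 : 0 <= - a by lra.
rewrite ge0_integralZl_real; [|by nonneg|by meas|by nonneg].
rewrite ge0_integralZl_real; [|by nonneg|by meas|by nonneg].
rewrite (volterra_intE s aN a1 v0) -!EFinM -EFinD; congr (_%:E).
have [sv|vs] := lerP s v.
  rewrite [tpow 0 (s - v)]tpow_le0 ?subr_le0// [tpow a (s - v)]tpow_le0 ?subr_le0//.
  suff -> : volterra_int a s v = 0 by rewrite !(mulr0, mul0r) addr0.
  rewrite /volterra_int set_itv_ge ?Rintegral_set0//.
  by rewrite bnd_simp -leNgt.
rewrite tpow0 ?subr_gt0// !tpowE ?subr_gt0 ?(lt_trans v0)//.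
by rewrite /volterra; ring.
Qed.

Lemma volterra_ge0_neg a s v : - 2^-1 < a -> a < 0 -> 0 < v -> v < s ->
  0 <= volterra a s v.
Proof.
move=> aN a0 v0 vs; rewrite /volterra addr_ge0 ?mulr_ge0 ?powR_ge0// -mulNr.
by rewrite mulr_ge0 ?volterra_int_ge0//; lra.
Qed.

(** Serves the term [v^(2a)] of [volterra_neg], which cancels the weight [v^(-2a)]. *)
Lemma integral_volterra_neg a s : -1 < 2 * a -> a < 0 -> 0 < s ->
  (\int[mu]_v (tpow 0 v * (tpow 0 (s - v) * volterra a s v))%:E
   = (tpow (2 * a + 1) s / (2 * a + 1))%:E)%E.
Proof.
move=> aN a0 s0; have aN1 : -1 < a by lra.
have a10 : 0 < a + 1 by lra.
have a210 : 0 < 2 * a + 1 by lra.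
have na0 : 0 <= - a by lra.
pose F v z := tpow 0 v * (- a * (tpow (a - 1) z * tpow a (z - v) * tpow 0 (s - z))).
have mF : measurable_fun setT (fun x : R * R => (F x.1 x.2)%:E) by rewrite /F; meas.
have F0 v z : 0 <= F v z by nonneg.
transitivity (\int[mu]_v ((tpow 0 v * (tpow a s * tpow a (s - v)))%:E + \int[mu]_z (F v z)%:E))%E.
  apply: eq_integral => v _; apply: volterra_intM => //; first by nonneg.
  by case: (ltP 0 v) => v0; [left|right; rewrite tpow_le0].
rewrite ge0_integralD//; first last.
- by apply: (@measurable_integral_fst R (fun v z => (F v z)%:E)).
- by move=> v _; apply: integral_ge0 => z _; rewrite lee_fin.
- by meas.
- by nonneg.
have I1 : (\int[mu]_v (tpow 0 v * (tpow a s * tpow a (s - v)))%:E = (tpow (2 * a + 1) s / (a + 1))%:E)%E.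
  transitivity (\int[mu]_v (tpow a s * (tpow (a + 1 - 1) (s - v) * tpow 0 (v - 0)))%:E)%E.
    by apply: eq_integral => v _; rewrite addrK subr0; congr (_%:E); ring.
  rewrite ge0_integralZl_real; [|by nonneg|by meas|by nonneg].
  rewrite (integral_tpow_leftN 0 s a10) subr0 -EFinM mulrA tpowMr; congr (tpow _ _ / _)%:E; ring.
have I2 : (\int[mu]_v \int[mu]_z (F v z)%:E = (- a / (a + 1) * (tpow (2 * a + 1) s / (2 * a + 1)))%:E)%E.
  rewrite (ge0_integral_swap mF); last by move=> v z; rewrite lee_fin.
  transitivity (\int[mu]_z (- a / (a + 1) * (tpow (2 * a + 1 - 1) (z - 0) * tpow 0 (s - z)))%:E)%E.
    apply: eq_integral => z _.
    transitivity (\int[mu]_v (- a * (tpow (a - 1) z * tpow 0 (s - z)) * (tpow (a + 1 - 1) (z - v) * tpow 0 (v - 0)))%:E)%E.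
      by apply: eq_integral => v _; congr (_%:E); rewrite /F addrK subr0; ring.
    rewrite ge0_integralZl_real; [|by nonneg|by meas|by nonneg].
    rewrite (integral_tpow_leftN 0 z a10) -EFinM subr0; congr (_%:E).
    rewrite (_ : 2 * a + 1 - 1 = a - 1 + (a + 1)); last by ring.
    by rewrite (tpowD (a - 1) (a + 1)); field; lra.
  rewrite ge0_integralZl_real; [|by rewrite divr_ge0// ltW|by meas|by nonneg].
  by rewrite (integral_tpow_left 0 s a210) subr0 -EFinM.
apply: (etrans (f_equal2 adde I1 I2)); rewrite -[LHS]EFinD; congr (_%:E).
by field; lra.
Qed.

(** Serves the tail term of [volterra_neg], with [tau > t]. Both terms of [volterra a s v] reduce to
    [L], hence to integrals over [x > tau]; separately these have no simple form, but their sum is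
    the derivative integrated in [integral_shift_diff]. *)
Lemma integral_volterra_kernel_neg a s tau : - 2^-1 < a -> a < 0 -> 0 < s -> s < tau ->
  (\int[mu]_v (tpow (- 2 * a) v * tpow (a - 1) (tau - v) * (tpow 0 (s - v) * volterra a s v))%:E
   = (cov_coef a * (tpow (- a) tau * (tpow (2 * a) (tau - s) - tpow (2 * a) tau) / (2 * - a)))%:E)%E.
Proof.
move=> aN a0 s0 stau; have aN1 : -1 < a by lra.
have na0 : 0 <= - a by lra.
have a20 : 2 * a < 0 by lra.
have A0 : 0 <= cov_coef a.
  by rewrite /cov_coef divr_ge0 ?mulr_ge0//; apply/ltW/Gamma_gt0; lra.
pose L z := (\int[mu]_v (tpow (- 2 * a) v * tpow (a - 1) (tau - v) * tpow a (z - v))%:E)%E.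
pose K z x := tpow (1 - a) z * tpow (2 * a - 1) (x - z) * tpow (- 1 - a) x * tpow 0 (x - tau).
have K0 z x : 0 <= K z x by nonneg.
have mK : measurable_fun setT (fun x : R * R => K x.1 x.2) by rewrite /K; meas.
have mKz z : measurable_fun setT (K z) by rewrite /K; meas.
have LE z : 0 < z -> z < tau -> (L z = \int[mu]_x (cov_coef a * K z x)%:E)%E.
  by move=> z0 zt; exact: integral_tpow_triple.
pose F v z := tpow (- 2 * a) v * tpow (a - 1) (tau - v) *
  (- a * (tpow (a - 1) z * tpow a (z - v) * tpow 0 (s - z))).
have mF : measurable_fun setT (fun x : R * R => (F x.1 x.2)%:E) by rewrite /F; meas.
have F0 v z : 0 <= F v z by nonneg.
transitivity (\int[mu]_v ((tpow (- 2 * a) v * tpow (a - 1) (tau - v) * (tpow a s * tpow a (s - v)))%:E + \int[mu]_z (F v z)%:E))%E.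
  apply: eq_integral => v _; apply: volterra_intM => //; first by nonneg.
  by case: (ltP 0 v) => v0; [left|right; rewrite tpow_le0 ?mul0r].
rewrite ge0_integralD//; first last.
- by apply: (@measurable_integral_fst R (fun v z => (F v z)%:E)).
- by move=> v _; apply: integral_ge0 => z _; rewrite lee_fin.
- by meas.
- by nonneg.
pose h x := tpow (- 1 - a) x * tpow 0 (x - tau).
have h0 x : 0 <= h x by nonneg.
have I1 : (\int[mu]_v (tpow (- 2 * a) v * tpow (a - 1) (tau - v) * (tpow a s * tpow a (s - v)))%:E
    = \int[mu]_x (cov_coef a * (h x * (s * tpow (2 * a - 1) (x - s))))%:E)%E.
  transitivity (\int[mu]_v (tpow a s * (tpow (- 2 * a) v * tpow (a - 1) (tau - v) * tpow a (s - v)))%:E)%E.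
    by apply: eq_integral => v _; congr (_%:E); ring.
  rewrite ge0_integralZl_real; [|by nonneg|by meas|by nonneg].
  rewrite -/(L s) (LE _ s0 stau) -ge0_integralZl_real; [|by nonneg|by meas|by nonneg].
  apply: eq_integral => x _; congr (_%:E); rewrite /K /h.
  have sE : s = tpow a s * tpow (1 - a) s.
    by rewrite tpowMr (_ : a + (1 - a) = 1) ?tpow1//; ring.
  rewrite [X in _ = _ * (_ * (X * _))]sE; ring.
have I2 : (\int[mu]_v \int[mu]_z (F v z)%:E
    = \int[mu]_x (cov_coef a * (h x * ((tpow (2 * a) (x - s) - tpow (2 * a) x) / 2)))%:E)%E.
  rewrite (ge0_integral_swap mF); last by move=> v z; rewrite lee_fin.
  pose H z x := - a * cov_coef a * h x * (tpow 0 (z - 0) * tpow 0 (s - z) * tpow (2 * a - 1) (x - z)).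
  have H0 z x : 0 <= H z x by nonneg.
  have mH : measurable_fun setT (fun x : R * R => (H x.1 x.2)%:E) by rewrite /H /h; meas.
  transitivity (\int[mu]_z \int[mu]_x (H z x)%:E)%E.
    apply: eq_integral => z _.
    transitivity ((- a * (tpow (a - 1) z * tpow 0 (s - z)))%:E * L z)%E.
      rewrite /L -ge0_integralZl_real; [|by nonneg|by meas|by nonneg].
      by apply: eq_integral => v _; congr (_%:E); rewrite /F; ring.
    have [z0|z0] := lerP z 0.
      rewrite (tpow_le0 _ z0) !(mul0r, mulr0) mul0e integral0_eq// => x _.
      by rewrite /H subr0 (tpow_le0 _ z0) !(mul0r, mulr0).
    have [sz|zs] := lerP s z.
      rewrite [tpow 0 _]tpow_le0 ?subr_le0// !(mul0r, mulr0) mul0e integral0_eq// => x _.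
      by rewrite /H [tpow 0 (s - z)]tpow_le0 ?subr_le0// !(mul0r, mulr0).
    rewrite (LE _ z0 (lt_trans zs stau)) -ge0_integralZl_real; [|by nonneg|by meas|by nonneg].
    apply: eq_integral => x _; congr (_%:E); rewrite /H /K /h subr0 [tpow 0 z]tpow0//.
    (* The power [z^(1-a)] from Feynman's formula cancels the [z^(a-1)] of the kernel, so only
       [(x - z)^(2a-1)] depends on [z]. *)
    have E1 : tpow (a - 1) z * tpow (1 - a) z = 1.
      by rewrite tpowMr (_ : a - 1 + (1 - a) = 0) ?tpow0//; ring.
    transitivity ((tpow (a - 1) z * tpow (1 - a) z) * (- a * tpow 0 (s - z) * (cov_coef a * (tpow (2 * a - 1) (x - z) * tpow (- 1 - a) x * tpow 0 (x - tau))))).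
      by ring.
    by rewrite E1; ring.
  rewrite (ge0_integral_swap mH); last by move=> z x; rewrite lee_fin.
  apply: eq_integral => x _.
  rewrite /H ge0_integralZl_real; [|by nonneg|by meas|by nonneg].
  have [xt|tx] := lerP x tau.
    by rewrite /h [tpow 0 (x - tau)]tpow_le0 ?subr_le0// !(mul0r, mulr0, mul0e).
  (* The factor [1/2] arises as [- a] divided by the [- 2a] of the integration. *)
  rewrite (integral_tpow_diffN a20 (ltW s0) (lt_trans stau tx)) -EFinM subr0; congr (_%:E).
  by move: (cov_coef a) (h x) (tpow _ _) (tpow _ _) => c1 c2 c3 c4; field; lra.
apply: (etrans (f_equal2 adde I1 I2)).
have hD x : 0 <= h x * ((tpow (2 * a) (x - s) - tpow (2 * a) x) / 2).
  have [xt|tx] := lerP x tau.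
    by rewrite /h [tpow 0 (x - tau)]tpow_le0 ?subr_le0// !(mulr0, mul0r).
  have sx := lt_trans stau tx; have x0 := lt_trans s0 sx.
  apply: mulr_ge0 => //; apply: mulr_ge0 => //.
  rewrite subr_ge0 !tpowE ?subr_gt0//.
  rewrite -[2 * a]opprK ![_ `^ (- - _)]powRN lef_pV2 ?posrE ?powR_gt0 ?subr_gt0//.
  by rewrite ge0_ler_powR ?nnegrE//; lra.
rewrite -[LHS]ge0_integralD_real; first last.
- by move=> x; apply: mulr_ge0 => //; exact: hD.
- by nonneg.
- by rewrite /h; meas.
- by rewrite /h; meas.
transitivity (\int[mu]_x (cov_coef a * (tpow 0 (x - tau) * (tpow (- 1 - a) x *
      (s * tpow (2 * a - 1) (x - s) + (tpow (2 * a) (x - s) - tpow (2 * a) x) / 2))))%:E)%E.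
  by apply: eq_integral => x _; congr (_%:E); rewrite /h; ring.
rewrite ge0_integralZl_real//; first last.
- by move=> x; rewrite mulrA [tpow 0 _ * _]mulrC -/(h x) mulrDr addr_ge0//; nonneg.
- by meas.
by rewrite (integral_shift_diff aN a0 s0 stau) -EFinM.
Qed.


(** Only [volterra a t v] is expanded, by [volterra_neg]; [volterra a s v] stays inside the
    nonnegative weight [W]. The term in [v^(2a)] yields [s^(2a+1)], the tail yields
    [t^(2a+1) - (t - s)^(2a+1)]. *)
Lemma volterra_cov_neg a s t : - 2^-1 < a -> a < 0 -> 0 < s -> s <= t ->
  (\int[mu]_v (tpow (- 2 * a) v * tpow 0 (s - v) * (volterra a t v * volterra a s v))%:E
   = (cov_coef a / 2 / (2 * a + 1) *
      (tpow (2 * a + 1) s + tpow (2 * a + 1) t - tpow (2 * a + 1) (t - s)))%:E)%E.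
Proof.
move=> aN a0 s0 st; have aN1 : -1 < a by lra.
have a2N : -1 < 2 * a by lra.
have a20 : 2 * a < 0 by lra.
have a210 : 0 < 2 * a + 1 by lra.
have na0 : 0 <= - a by lra.
have A0 : 0 <= cov_coef a.
  by rewrite /cov_coef divr_ge0 ?mulr_ge0//; apply/ltW/Gamma_gt0; lra.
pose W v := tpow (- 2 * a) v * (tpow 0 (s - v) * volterra a s v).
have W0 v : 0 <= W v.
  have [v0|v0] := lerP v 0; first by rewrite /W tpow_le0 ?mul0r.
  have [sv|vs] := lerP s v; first by rewrite /W [tpow 0 _]tpow_le0 ?subr_le0// mul0r mulr0.
  by rewrite !mulr_ge0 ?tpow_ge0// volterra_ge0_neg.
have mW : measurable_fun setT W.
  apply/measurable_EFinP.
  pose F v z := tpow (- 2 * a) v * (- a * (tpow (a - 1) z * tpow a (z - v) * tpow 0 (s - z))).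
  have mF : measurable_fun setT (fun x : R * R => (F x.1 x.2)%:E) by rewrite /F; meas.
  have F0 v z : 0 <= F v z by nonneg.
  rewrite (_ : _ \o _ = (fun v => (tpow (- 2 * a) v * (tpow a s * tpow a (s - v)))%:E
     + \int[mu]_z (F v z)%:E)%E).
    apply: emeasurable_funD; first by meas.
    by apply: (@measurable_integral_fst R (fun v z => (F v z)%:E)).
  apply/funext => v; apply: volterra_intM => //; first by nonneg.
  by case: (ltP 0 v) => v0; [left|right; rewrite tpow_le0].
pose k v z := - a * (tpow a z * tpow (a - 1) (z - v) * tpow 0 (z - t)).
have k0 v z : 0 <= k v z by nonneg.
have mk v : measurable_fun setT (k v) by rewrite /k; meas.
have mWk : measurable_fun setT (fun x : R * R => (W x.1 * k x.1 x.2)%:E).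
  have mW1 : measurable_fun setT (fun x : R * R => W x.1) by exact: (measurableT_comp mW).
  by rewrite /k; meas.
have Wk0 v z : 0 <= W v * k v z by rewrite mulr_ge0.
have tW0 v : 0 <= tpow (2 * a) v * W v by apply: mulr_ge0; [exact: tpow_ge0|exact: W0].
transitivity (\int[mu]_v (\int[mu]_z (W v * k v z)%:E + (cov_coef a / 2 * (tpow (2 * a) v * W v))%:E))%E.
  apply: eq_integral => v _; rewrite ge0_integralZl_real//.
  have [v0|v0] := lerP v 0.
    by rewrite /W (tpow_le0 _ v0) !(mul0r, mulr0, mul0e) adde0.
  have [sv|vs] := lerP s v.
    by rewrite /W [tpow 0 _]tpow_le0 ?subr_le0// !(mul0r, mulr0, mul0e) adde0.
  have -> : tpow (- 2 * a) v * tpow 0 (s - v) * (volterra a t v * volterra a s v) = W v * volterra a t v.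
    by rewrite /W; ring.
  rewrite EFinM -(volterra_neg aN a0 v0 (lt_le_trans vs st)) ge0_muleDr; [|by apply: integral_ge0; nonneg|by nonneg].
  by congr (_ + _)%E; rewrite -EFinM; congr (_%:E); ring.
rewrite ge0_integralD//; first last.
- by apply: measurable_EFin_comp; meas.
- by move=> v _; rewrite lee_fin; apply: mulr_ge0 => //; nonneg.
- by apply: (@measurable_integral_fst R (fun v z => (W v * k v z)%:E)).
- by move=> v _; apply: integral_ge0 => z _; rewrite lee_fin.
have I2 : (\int[mu]_v (cov_coef a / 2 * (tpow (2 * a) v * W v))%:E
    = (cov_coef a / 2 * (tpow (2 * a + 1) s / (2 * a + 1)))%:E)%E.
  rewrite ge0_integralZl_real; [|by nonneg|by meas|exact: tW0].
  rewrite [RHS]EFinM -(integral_volterra_neg a2N a0 s0); congr (_ * _)%E.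
  apply: eq_integral => v _; rewrite /W mulrA tpowMr; congr (tpow _ _ * _)%:E; ring.
have I1 : (\int[mu]_v \int[mu]_z (W v * k v z)%:E
    = (cov_coef a / 2 * ((tpow (2 * a + 1) t - tpow (2 * a + 1) (t - s)) / (2 * a + 1)))%:E)%E.
  rewrite (ge0_integral_swap mWk); last by move=> v z; rewrite lee_fin.
  (* The factor [z^a] of [k] cancels the [z^(-a)] of [integral_volterra_kernel_neg]. The remaining
     [(z - s)^(2a) - z^(2a)] is written back as an integral over [w] in []0, s[], so that [z > t]
     can be integrated first. *)
  pose H z w := - a * cov_coef a * tpow 0 (w - 0) * tpow 0 (s - w) * (tpow 0 (z - t) * tpow (2 * a - 1) (z - w)).
  have H0 z x : 0 <= H z x by nonneg.
  have mH : measurable_fun setT (fun x : R * R => (H x.1 x.2)%:E) by rewrite /H; meas.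
  transitivity (\int[mu]_z \int[mu]_w (H z w)%:E)%E.
    apply: eq_integral => z _.
    have [zt|tz] := lerP z t.
      rewrite !integral0_eq// => w _.
        by rewrite /H [tpow 0 (z - t)]tpow_le0 ?subr_le0// !(mul0r, mulr0).
      by rewrite /k [tpow 0 (z - t)]tpow_le0 ?subr_le0// !(mul0r, mulr0).
    have sz := le_lt_trans st tz; have z0 := lt_trans s0 sz.
    transitivity (\int[mu]_v (- a * tpow a z * (tpow (- 2 * a) v * tpow (a - 1) (z - v) * (tpow 0 (s - v) * volterra a s v)))%:E)%E.
      apply: eq_integral => v _; rewrite /W /k [tpow 0 (z - t)]tpow0 ?subr_gt0//.
      by congr (_%:E); ring.
    have Wz0 v : 0 <= tpow (- 2 * a) v * tpow (a - 1) (z - v) * (tpow 0 (s - v) * volterra a s v).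
      by rewrite mulrAC mulr_ge0 ?tpow_ge0//; exact: W0.
    rewrite ge0_integralZl_real; [|by nonneg| |exact: Wz0]; last first.
      have mWt : measurable_fun setT (fun v => W v * tpow (a - 1) (z - v)) by meas.
      by apply: eq_measurable_fun mWt => v _; rewrite /W mulrAC.
    rewrite (integral_volterra_kernel_neg aN a0 s0 sz).
    transitivity (\int[mu]_w (- a * cov_coef a * (tpow 0 (w - 0) * tpow 0 (s - w) * tpow (2 * a - 1) (z - w)))%:E)%E; last first.
      apply: eq_integral => w _; rewrite /H [tpow 0 (z - t)]tpow0 ?subr_gt0//.
      by congr (_%:E); ring.
    rewrite ge0_integralZl_real; [|by nonneg|by meas|by nonneg].
    rewrite (integral_tpow_diffN a20 (ltW s0) sz) -!EFinM subr0; congr (_%:E).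
    have := tpowV a z0; have := lt0r_neq0 (tpow_gt0 a z0).
    move: (cov_coef a) (tpow a z) (tpow (- a) z) (tpow _ _) (tpow _ _) => c1 c2 c3 c4 c5 c20 ->.
    by field; rewrite c20; lra.
  rewrite (ge0_integral_swap mH); last by move=> z x; rewrite lee_fin.
  transitivity (\int[mu]_w (cov_coef a / 2 * (tpow 0 (w - 0) * tpow 0 (s - w) * tpow (2 * a + 1 - 1) (t - w)))%:E)%E.
    apply: eq_integral => w _; rewrite /H ge0_integralZl_real; [|by nonneg|by meas|by nonneg].
    have [sw|ws] := lerP s w.
      by rewrite [tpow 0 (s - w)]tpow_le0 ?subr_le0// !(mul0r, mulr0, mul0e).
    rewrite (integral_tpow_rightD a20 (lt_le_trans ws st)) -EFinM addrK; congr (_%:E).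
    by move: (cov_coef a) (tpow _ _) (tpow _ _) (tpow _ _) => c1 c2 c3 c4; field; lra.
  rewrite ge0_integralZl_real; [|by nonneg|by meas|by nonneg].
  by rewrite (integral_tpow_diff a210 (ltW s0) st) -EFinM subr0.
apply: (etrans (f_equal2 adde I1 I2)); rewrite -[LHS]EFinD; congr (_%:E).
by move: (cov_coef a) (tpow _ _) (tpow _ _) (tpow _ _) => c1 c2 c3 c4; field; lra.
Qed.

End CovarianceNegative.

(** * From [volterra] back to [fbm_kernel]: the covariance as an integral *)

Section KernelCovariance.
Variable R : realType.
Implicit Types (a b c d p q r s t u v w x y H : R).
Local Notation mu := (@lebesgue_measure R).
Local Notation G := (@Gamma R).

Lemma volterra_cov a s t : - 2^-1 < a -> a < 2^-1 -> a != 0 -> 0 < s -> s <= t ->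
  (\int[mu]_v (tpow (- 2 * a) v * tpow 0 (s - v) * (volterra a t v * volterra a s v))%:E
   = (cov_coef a / 2 / (2 * a + 1) *
      (tpow (2 * a + 1) s + tpow (2 * a + 1) t - tpow (2 * a + 1) (t - s)))%:E)%E.
Proof.
move=> aN a2; rewrite neq_lt => /orP[a0|a0]; [exact: volterra_cov_neg|exact: volterra_cov_pos].
Qed.

Lemma volterra_ge0 a s v : - 2^-1 < a -> a < 2^-1 -> 0 < v -> v < s ->
  0 <= volterra a s v.
Proof.
move=> aN a2 v0 vs; have [a0|a0] := ltP a 0; first exact: volterra_ge0_neg.
have [->|an0] := eqVneq a 0.
  by rewrite /volterra mul0r subr0 mulr_ge0 ?powR_ge0.
have {an0} a0 : 0 < a by rewrite lt_neqAle eq_sym an0.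
have a1 : a < 1 by lra.
rewrite -lee_fin -(volterra_pos a0 a1 v0 vs).
by apply: integral_ge0; nonneg.
Qed.

Lemma measurable_volterra_int a t : -1 < a -> a < 1 ->
  measurable_fun setT (fun v => tpow 0 v * volterra_int a t v).
Proof.
move=> aN a1; apply/measurable_EFinP.
pose F v z := tpow 0 v * (tpow (a - 1) z * tpow a (z - v) * tpow 0 (t - z)).
have mF : measurable_fun setT (fun x : R * R => (F x.1 x.2)%:E) by rewrite /F; meas.
have F0 v z : 0 <= F v z by nonneg.
rewrite (_ : _ \o _ = (fun v => \int[mu]_z (F v z)%:E)%E).
  by apply: (@measurable_integral_fst R (fun v z => (F v z)%:E)).
apply/funext => v; rewrite /F ge0_integralZl_real; [|by nonneg|by meas|by nonneg].
have [v0|v0] := lerP v 0; first by rewrite /= (tpow_le0 _ v0) mul0r mul0e.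
by rewrite (volterra_intE t aN a1 v0).
Qed.

Lemma measurable_volterra p a t : -1 < a -> a < 1 ->
  measurable_fun setT (fun v => tpow p v * volterra a t v).
Proof.
move=> aN a1; have mV := measurable_volterra_int t aN a1.
rewrite (_ : (fun v => _) = (fun v => tpow p v * (t `^ a * (t - v) `^ a)
    - a * (tpow p v * (tpow 0 v * volterra_int a t v)))).
  have mP : measurable_fun setT (fun v => (t - v) `^ a).
    by apply: (measurableT_comp (measurable_powR a)); meas.
  by meas.
by apply/funext => v; rewrite /volterra [tpow p v * (tpow 0 v * _)]mulrA tpowMr addr0; ring.
Qed.

Lemma fbm_kernelE H t v : 0 < v -> v < t ->
  fbm_kernel H t v = fbm_const H * (tpow (- (H - 1 / 2)) v * volterra (H - 1 / 2) t v).
Proof.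
move=> v0 vt; rewrite /fbm_kernel /volterra /volterra_int; congr (_ * _).
set a := H - 1 / 2.
rewrite (_ : 1 / 2 - H = - a); last by rewrite /a; ring.
rewrite (_ : H - 3 / 2 = a - 1); last by rewrite /a; field.
rewrite powRM ?invr_ge0 ?(ltW v0) ?(ltW (lt_trans v0 vt))//.
have -> : v^-1 `^ a = v `^ (- a) by rewrite -powR_inv1 ?ltW// -powRrM mulN1r.
rewrite tpowE//; ring.
Qed.

(** The Gamma factors of [d_H^2] are those of [cov_coef] inverted. *)
Lemma fbm_const_sqr H : 0 < H -> H < 1 ->
  fbm_const H ^+ 2 * cov_coef (H - 1 / 2) = 2 * H.
Proof.
move=> H0 H1; rewrite /fbm_const /cov_coef.
rewrite (_ : 1 + (H - 1 / 2) = H + 1 / 2); last by field.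
rewrite (_ : 1 - 2 * (H - 1 / 2) = 2 - 2 * H); last by field.
rewrite (_ : 1 - (H - 1 / 2) = 3 / 2 - H); last by field.
have g1 : 0 < G (3 / 2 - H) by apply: Gamma_gt0; lra.
have g2 : 0 < G (H + 1 / 2) by apply: Gamma_gt0; lra.
have g3 : 0 < G (2 - 2 * H) by apply: Gamma_gt0; lra.
move: g1 g2 g3; move: (G _) (G _) (G _) => x y z x0 y0 z0.
rewrite sqr_sqrtr; last by rewrite divr_ge0 ?mulr_ge0 ?ltW.
by field; rewrite !gt_eqF.
Qed.

Lemma integral_fbm_kernel H s t : 0 < H -> H < 1 -> H != 1 / 2 -> 0 < s -> s <= t ->
  (\int[mu]_(v in `]0%R, s[) (fbm_kernel H t v * fbm_kernel H s v)%:E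
    = (fbm_cov H t s)%:E)%E.
Proof.
move=> H0 H1 Hn s0 st; pose a := H - 1 / 2.
have aN : - 2^-1 < a by rewrite /a; lra.
have a2 : a < 2^-1 by rewrite /a; lra.
have an0 : a != 0 by rewrite /a subr_eq0.
pose V r v := tpow (- a) v * volterra a r v.
have mV r : measurable_fun setT (V r) by apply: measurable_volterra; lra.
pose K v := tpow 0 (s - v) * (V t v * V s v).
have KE v : K v = tpow (- 2 * a) v * tpow 0 (s - v) * (volterra a t v * volterra a s v).
  rewrite (_ : - 2 * a = - a - a); last by ring.
  by rewrite /K /V tpowD; ring.
have K0 v : 0 <= K v.
  have [v0|v0] := lerP v 0; first by rewrite /K /V (tpow_le0 _ v0) !(mul0r, mulr0).
  have [sv|vs] := lerP s v; first by rewrite /K [tpow 0 _]tpow_le0 ?subr_le0// mul0r.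
  by rewrite !mulr_ge0 ?tpow_ge0// volterra_ge0// (lt_le_trans vs).
transitivity (\int[mu]_v (fbm_const H ^+ 2 * K v)%:E)%E.
  apply: integral_restrictE => v /=; rewrite in_itv/=.
    move=> /andP[v0 vs]; rewrite !fbm_kernelE// ?(lt_le_trans vs)//.
    by rewrite /K /V tpow0 ?subr_gt0//; ring.
  move=> /negP; rewrite negb_and -!leNgt => /orP[v0|sv].
    by rewrite /K /V (tpow_le0 _ v0) !(mul0r, mulr0).
  by rewrite /K [tpow 0 _]tpow_le0 ?subr_le0// mul0r mulr0.
rewrite ge0_integralZl_real//; [|by rewrite sqr_ge0|apply: measurable_funM; [meas|exact: (measurable_funM (mV t) (mV s))]].
have -> : (\int[mu]_v (K v)%:E = \int[mu]_v (tpow (- 2 * a) v * tpow 0 (s - v) * (volterra a t v * volterra a s v))%:E)%E.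
  by apply: eq_integral => v _; rewrite KE.
rewrite (volterra_cov aN a2 an0 s0 st) -EFinM; congr (_%:E).
rewrite (_ : 2 * a + 1 = 2 * H); last by rewrite /a; field.
rewrite (tpowE _ s0) (tpowE _ (lt_le_trans s0 st)).
(* The two powers also agree at [t = s], where both are 0 because [2 H] is not 0. *)
have -> : tpow (2 * H) (t - s) = `|t - s| `^ (2 * H).
  rewrite ger0_norm ?subr_ge0// /tpow; case: ltP => // ts0.
  have -> : t - s = 0 by apply/eqP; rewrite eq_le ts0 subr_ge0.
  by rewrite powR0// mulf_neq0// gt_eqF.
have := fbm_const_sqr H0 H1; rewrite -/a /fbm_cov.
move: (fbm_const H ^+ 2) (cov_coef a) (s `^ _) (t `^ _) (`|_| `^ _) => c1 c2 c3 c4 c5 E.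
transitivity (c1 * c2 / (2 * (2 * H)) * (c3 + c4 - c5)); first by field; rewrite gt_eqF.
by rewrite E; field; rewrite gt_eqF.
Qed.

(** The integrand is nonnegative and its integral is the finite number [fbm_cov H t s]. *)
Lemma integrable_fbm_kernel H s t : 0 < H -> H < 1 -> H != 1 / 2 -> 0 < s -> s <= t ->
  mu.-integrable `]0, s[ (EFin \o (fun v => fbm_kernel H t v * fbm_kernel H s v)).
Proof.
move=> H0 H1 Hn s0 st; pose a := H - 1 / 2.
have aN : - 2^-1 < a by rewrite /a; lra.
have a2 : a < 2^-1 by rewrite /a; lra.
have mV r : measurable_fun setT (fun v => tpow (- a) v * volterra a r v).
  by apply: measurable_volterra; lra.
apply/integrableP; split.
  apply/measurable_EFinP.
  apply: (@eq_measurable_fun _ _ _ _ _ (fun v => fbm_const H * (tpow (- a) v * volterra a t v)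
     * (fbm_const H * (tpow (- a) v * volterra a s v)))).
    move=> v; rewrite inE/= in_itv/= => /andP[v0 vs].
    by rewrite !fbm_kernelE// (lt_le_trans vs).
  apply: measurable_funTS; apply: measurable_funM; apply: measurable_funM;
    by [exact: measurable_cst|exact: mV].
rewrite [X in (X < _)%E](_ : _ = (fbm_cov H t s)%:E) ?ltry//.
rewrite -integral_fbm_kernel//; apply: eq_integral.
move=> v; rewrite inE/= in_itv/= => /andP[v0 vs].
rewrite /= ger0_norm// !fbm_kernelE// ?(lt_le_trans vs)//.
by rewrite !mulr_ge0 ?tpow_ge0 ?sqrtr_ge0// volterra_ge0// (lt_le_trans vs).
Qed.

Lemma fbm_cond_covE H t s u : 0 < H -> H < 1 -> H != 1 / 2 -> 0 < s -> s <= t ->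
  0 < u -> u < s ->
  fbm_cond_cov H t s u =
  \int[mu]_(v in `]u, s[) (fbm_kernel H t v * fbm_kernel H s v).
Proof.
move=> H0 H1 Hn s0 st u0 us.
have Ki := integrable_fbm_kernel H0 H1 Hn s0 st.
rewrite /fbm_cond_cov.
have -> : fbm_cov H t s = \int[mu]_(v in `]0, s[) (fbm_kernel H t v * fbm_kernel H s v).
  by rewrite /Rintegral integral_fbm_kernel.
rewrite [X in _ - X]Rintegral_itv_bndo_bndc; last first.
  apply: integrableS Ki => // v /=; rewrite !in_itv/= => /andP[-> vu] /=.
  exact: lt_trans us.
by rewrite Rintegral_itvB// ?bnd_simp ?ltW.
Qed.

End KernelCovariance.

(** * Behaviour of the kernels and of their integrals as [v] tends to [s] from the left *)

Section Asymptotics.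
Variable R : realType.
Implicit Types (a b c d e p q r s t u v w x y H : R).
Local Notation mu := (@lebesgue_measure R).

Lemma integrableZl_real c (D : set R) (f : R -> R) : measurable D ->
  mu.-integrable D (EFin \o f) -> mu.-integrable D (EFin \o (fun v => c * f v)).
Proof.
move=> mD fi; rewrite (_ : EFin \o (fun v => c * f v) = (fun v => c%:E * (EFin \o f) v)%E).
  exact: integrableZl.
by apply/funext => v.
Qed.

Lemma near_at_left_itv s (P : R -> Prop) : (\forall v \near s^'-, P v) ->
  \forall u \near s^'-, forall v, u < v -> v < s -> P v.
Proof.
case=> e /= e0 He; near=> u => v uv vs; apply: He => //=.
rewrite ger0_norm ?subr_ge0 ?ltW// ltrBlDr -ltrBlDl (lt_trans _ uv)//.
by near: u; apply: nbhs_left_gt; rewrite ltrBlDr ltrDl.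
Unshelve. all: by end_near. Qed.

Lemma integral_powR_left e u s : -1 < e -> u < s ->
  (\int[mu]_(v in `]u, s[) ((s - v) `^ e)%:E = ((s - u) `^ (e + 1) / (e + 1))%:E)%E.
Proof.
move=> e1 us; have e10 : 0 < e + 1 by lra.
rewrite -[(s - u) `^ _]tpowE ?subr_gt0// -(integral_tpow_leftN u s e10) addrK.
apply: integral_restrictE => v /=; rewrite in_itv/=.
  by move=> /andP[uv vs]; rewrite tpowE ?subr_gt0// tpow0 ?mulr1// subr_gt0.
move=> /negP; rewrite negb_and -!leNgt => /orP[vu|sv].
  by rewrite [tpow 0 _]tpow_le0 ?mulr0// subr_le0.
by rewrite tpow_le0 ?mul0r// subr_le0.
Qed.

Lemma integrable_powR_left e u s : -1 < e -> u < s ->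
  mu.-integrable `]u, s[ (EFin \o (fun v => (s - v) `^ e)).
Proof.
move=> e1 us; apply/integrableP; split.
  apply/measurable_EFinP; apply: measurable_funTS.
  by apply: (measurableT_comp (measurable_powR e)); meas.
rewrite [X in (X < _)%E](_ : _ = ((s - u) `^ (e + 1) / (e + 1))%:E) ?ltry//.
rewrite -integral_powR_left//; apply: eq_integral => v _.
by rewrite /= ger0_norm ?powR_ge0.
Qed.

Lemma Rintegral_powR_left e u s : -1 < e -> u < s ->
  \int[mu]_(v in `]u, s[) ((s - v) `^ e) = (s - u) `^ (e + 1) / (e + 1).
Proof. by move=> e1 us; rewrite /Rintegral integral_powR_left. Qed.

(** A pointwise estimate of [g - c (s - v)^e] that holds near [s] holds on all of []u, s[] for [u]
    close to [s], and is integrated there. *)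
Lemma Rintegral_asymptotic (g h : R -> R) c e s : -1 < e ->
  (\forall u \near s^'-, mu.-integrable `]u, s[ (EFin \o g)) ->
  (\forall v \near s^'-, g v = h v * (s - v) `^ e) ->
  h v @[v --> s^'-] --> c ->
  forall eps, 0 < eps -> \forall u \near s^'-,
   `|\int[mu]_(v in `]u, s[) g v - c / (e + 1) * (s - u) `^ (e + 1)|
     <= eps * (s - u) `^ (e + 1).
Proof.
move=> e1 ig gE hc eps eps0; have e10 : 0 < e + 1 by lra.
(* The factor [e + 1] compensates the one lost on integrating [(s - v)^e]. *)
have d0 : 0 < eps * (e + 1) by rewrite mulr_gt0.
have gb : \forall v \near s^'-, `|g v - c * (s - v) `^ e| <= eps * (e + 1) * (s - v) `^ e.
  have /cvgrPdist_le/(_ _ d0) hd := hc.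
  near=> v; have -> : g v = h v * (s - v) `^ e by near: v.
  rewrite -mulrBl normrM [X in _ * X]ger0_norm ?powR_ge0//.
  rewrite ler_wpM2r ?powR_ge0// distrC; near: v; exact: hd.
have gb' := near_at_left_itv gb.
near=> u.
have us : u < s by near: u; exact: nbhs_left_lt.
have igu : mu.-integrable `]u, s[ (EFin \o g) by near: u.
have ipu := integrable_powR_left e1 us.
have icpu : mu.-integrable `]u, s[ (EFin \o (fun v => c * (s - v) `^ e)).
  exact: integrableZl_real.
have iepu : mu.-integrable `]u, s[ (EFin \o (fun v => eps * (e + 1) * (s - v) `^ e)).
  exact: integrableZl_real.
have -> : c / (e + 1) * (s - u) `^ (e + 1) = \int[mu]_(v in `]u, s[) (c * (s - v) `^ e).
  by rewrite RintegralZl// Rintegral_powR_left//; ring.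
have -> : eps * (s - u) `^ (e + 1) = \int[mu]_(v in `]u, s[) (eps * (e + 1) * (s - v) `^ e).
  by rewrite RintegralZl// Rintegral_powR_left//; field; rewrite gt_eqF.
rewrite -RintegralB//.
have iB : mu.-integrable `]u, s[ (EFin \o (fun v => g v - c * (s - v) `^ e)).
  rewrite (_ : _ \o _ = ((EFin \o g) \- (EFin \o (fun v => (c * (s - v) `^ e)%R)))%E)//.
  exact: integrableB.
have gbu : forall v, u < v -> v < s ->
  `|g v - c * (s - v) `^ e| <= eps * (e + 1) * (s - v) `^ e by near: u.
apply: (le_trans (le_normr_Rintegral _ iB)) => //.
apply: le_Rintegral => //.
  rewrite (_ : _ \o _ = abse \o (EFin \o (fun v => (g v - c * (s - v) `^ e)%R))%E)//.
  exact: integrable_abse.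
by move=> v /=; rewrite in_itv/= => /andP[uv vs]; exact: gbu.
Unshelve. all: by end_near. Qed.

Lemma powR_cvg (F : set_system R) {FF : Filter F} (f : R -> R) x p : 0 < x ->
  f v @[v --> F] --> x -> f v `^ p @[v --> F] --> x `^ p.
Proof.
move=> x0 fx; have cp : {for x, continuous (@powR R ^~ p)}.
  apply: differentiable_continuous; apply/derivable1_diffP.
  by have [] := @is_derive1_powR R p x x0.
exact: (continuous_cvg FF cp fx).
Qed.

Lemma cvg_at_left_id s : v @[v --> s^'-] --> (s : R).
Proof. by apply: cvg_at_left_filter; exact: cvg_id. Qed.

(** By [volterra_int_le] the integral term has order [(s - v)^(a+1)], so after division by
    [(s - v)^a] it tends to 0; in the other term [s^a v^(-a)] tends to 1. *)
Lemma fbm_kernel_diag_cvg H s : 0 < H -> H < 1 -> 0 < s ->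
  fbm_kernel H s v * (s - v) `^ (- (H - 1 / 2)) @[v --> s^'-] --> fbm_const H.
Proof.
move=> H0 H1 s0; set a := H - 1 / 2.
have aN : - 2^-1 < a by rewrite /a; lra.
have a2 : a < 2^-1 by rewrite /a; lra.
have aN1 : -1 < a by lra.
have a1 : a < 1 by lra.
have a10 : 0 < a + 1 by lra.
have idc := @cvg_at_left_id s.
pose k v := v `^ (- a) * (v `^ (a - 1) * ((s - v) / (a + 1))).
have kc : k v @[v --> s^'-] --> s `^ (- a) * (s `^ (a - 1) * ((s - s) / (a + 1))).
  apply: cvgM; first exact: powR_cvg.
  apply: cvgM; first exact: powR_cvg.
  by apply: cvgMl; apply: cvgB => //; exact: cvg_cst.
rewrite subrr mul0r !mulr0 in kc.
pose r v := v `^ (- a) * (volterra_int a s v * (s - v) `^ (- a)).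
have rc : r v @[v --> s^'-] --> 0.
  apply: (@squeeze_cvgr _ _ _ _ (fun=> 0) k) => //; last exact: cvg_cst.
  near=> v.
  have v0 : 0 < v by near: v; exact: nbhs_left_gt.
  have vs : v < s by near: v; exact: nbhs_left_lt.
  have sv0 : 0 < s - v by rewrite subr_gt0.
  rewrite /r !mulr_ge0 ?powR_ge0 ?volterra_int_ge0//=.
  rewrite ler_wpM2l ?powR_ge0//.
  apply: (le_trans (ler_wpM2r (powR_ge0 _ _) (volterra_int_le s aN1 a1 v0))).
  rewrite !tpowE// -!mulrA ler_wpM2l ?powR_ge0//.
  have E : (s - v) `^ (a + 1) * (s - v) `^ (- a) = s - v.
    rewrite -powRD; last by rewrite (@gt_eqF _ _ (s - v)) ?implybT.
    by rewrite (_ : a + 1 - a = 1) ?powRr1 ?(ltW sv0)//; ring.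
  by rewrite mulrCA E mulrC.
apply: (@cvg_trans _ (fbm_const H * (s `^ a * v `^ (- a) - a * r v) @[v --> s^'-])).
  apply: near_eq_cvg; near=> v.
  have v0 : 0 < v by near: v; exact: nbhs_left_gt.
  have vs : v < s by near: v; exact: nbhs_left_lt.
  have sv0 : 0 < s - v by rewrite subr_gt0.
  rewrite fbm_kernelE// -/a /volterra /r tpowE//.
  have E : (s - v) `^ a * (s - v) `^ (- a) = 1.
    by rewrite -powRD ?subrr ?powRr0// (@gt_eqF _ _ (s - v)) ?implybT.
  transitivity (fbm_const H * (s `^ a * v `^ (- a) * ((s - v) `^ a * (s - v) `^ (- a)) -
    a * (v `^ (- a) * (volterra_int a s v * (s - v) `^ (- a))))).
    by rewrite E mulr1.
  by move: (fbm_const H) (s `^ _) (v `^ _) ((s - v) `^ _) ((s - v) `^ _) (volterra_int _ _ _) => x1 x2 x3 x4 x5 x6; ring.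
have {2}-> : fbm_const H = fbm_const H * (s `^ a * s `^ (- a) - a * 0).
  by rewrite mulr0 subr0 -powRD ?subrr ?powRr0 ?mulr1// (@gt_eqF _ _ s) ?implybT.
apply: cvgMr; apply: cvgB; last exact: cvgMr.
by apply: cvgMr; exact: powR_cvg.
Unshelve. all: by end_near. Qed.

(** The substitution of [v z] for [z] moves [v] from the integrand into the upper limit. Continuity
    in [v] thus becomes that of an indefinite integral, and the integral over []1, t / s[] in
    [cond_cov_const] appears. *)
Lemma volterra_int_scale a t v : -1 < a -> a < 1 -> 0 < v ->
  volterra_int a t v = v `^ (2 * a) * volterra_int a (t / v) 1.
Proof.
move=> aN1 a1 v0; apply: EFin_inj.
rewrite EFinM -(volterra_intE t aN1 a1 v0) -(volterra_intE (t / v) aN1 a1 ltr01).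
rewrite (@ge0_integral_affine _ v 0 _ v0); [|by meas|by nonneg].
transitivity (v%:E * \int[mu]_z (v `^ (2 * a - 1) * (tpow (a - 1) z * tpow a (z - 1) * tpow 0 (t / v - z)))%:E)%E.
  congr (_ * _)%E; apply: eq_integral => z _; congr (_%:E).
  rewrite addr0 (_ : t - v * z = v * (t / v - z)); last by field; rewrite gt_eqF.
  rewrite (_ : v * z - v = v * (z - 1)); last by ring.
  rewrite (tpowM _ z v0) (tpowM _ (z - 1) v0) (tpowM _ (t / v - z) v0) (tpow0 v0).
  have -> : v `^ (2 * a - 1) = tpow (a - 1) v * tpow a v.
    by rewrite tpowMr tpowE//; congr (_ `^ _); ring.
  ring.
rewrite ge0_integralZl_real ?powR_ge0//; [|by meas|by nonneg].
rewrite muleA; congr (_ * _)%E; rewrite -EFinM; congr (_%:E).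
by rewrite [RHS]powR_pred.
Qed.

(** An indefinite integral is continuous; [2 y] is merely a right end that makes [y] an interior
    point. *)
Lemma volterra_int_continuous a y : -1 < a -> a < 1 -> 1 < y ->
  {for y, continuous (fun x => volterra_int a x 1)}.
Proof.
move=> aN1 a1 y1; pose f w := tpow (a - 1) w * tpow a (w - 1).
have mf : measurable_fun setT f by rewrite /f; meas.
have f0 w : 0 <= f w by nonneg.
have fE x : (\int[mu]_(w in `[1%R, x]) (f w)%:E = (volterra_int a x 1)%:E)%E.
  rewrite -integral_itv_bndo_bndc; last by apply: measurable_funTS; meas.
  rewrite -(volterra_intE x aN1 a1 ltr01).
  apply: integral_restrictE => w /=; rewrite in_itv/=.
    by move=> /andP[_ wx]; rewrite [tpow 0 _]tpow0 ?mulr1// subr_gt0.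
  move=> /negP; rewrite negb_and -!leNgt -!ltNge => /orP[w1|xw].
    by rewrite [tpow a _]tpow_le0 ?(mulr0, mul0r)// subr_le0 ltW.
  by rewrite [tpow 0 _]tpow_le0 ?mulr0// subr_le0.
have yy : y < 2 * y by lra.
have y2 : 1 <= 2 * y by lra.
have fi : mu.-integrable `[1, 2 * y] (EFin \o f).
  apply/integrableP; split; first by apply: measurable_funTS; meas.
  rewrite [X in (X < _)%E](_ : _ = (volterra_int a (2 * y) 1)%:E) ?ltry//.
  by rewrite -fE; apply: eq_integral => v _; rewrite /= ger0_norm.
have H := parameterized_integral_continuous y2 fi.
have -> : (fun x => volterra_int a x 1) = (parameterized_integral mu 1)^~ f.
  by apply/funext => x; rewrite /parameterized_integral /Rintegral fE.
have y12 : 1 < 2 * y by lra.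
move/continuous_within_itvP : H => /(_ y12)[+ _ _]; apply.
by rewrite in_itv/= y1 yy.
Qed.

Lemma fbm_kernel_cvg H s t : 0 < H -> H < 1 -> 0 < s -> s < t ->
  fbm_kernel H t v @[v --> s^'-] --> fbm_kernel H t s.
Proof.
move=> H0 H1 s0 st; set a := H - 1 / 2.
have aN : - 2^-1 < a by rewrite /a; lra.
have a2 : a < 2^-1 by rewrite /a; lra.
have aN1 : -1 < a by lra.
have a1 : a < 1 by lra.
have t0 := lt_trans s0 st.
have ts0 : 0 < t - s by rewrite subr_gt0.
have idc := @cvg_at_left_id s.
pose k v := fbm_const H * (v `^ (- a) * (t `^ a * (t - v) `^ a - a * (v `^ (2 * a) * volterra_int a (t / v) 1))).
have kE v : 0 < v -> v < t -> fbm_kernel H t v = k v.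
  by move=> v0 vt; rewrite fbm_kernelE// -/a /volterra volterra_int_scale// tpowE.
rewrite (kE s s0 st); apply: (@cvg_trans _ (k v @[v --> s^'-])).
  apply: near_eq_cvg; near=> v.
  have v0 : 0 < v by near: v; exact: nbhs_left_gt.
  have vs : v < s by near: v; exact: nbhs_left_lt.
  by rewrite kE// (lt_trans vs).
apply: cvgMr; apply: cvgM; first exact: powR_cvg.
apply: cvgB.
  by apply: cvgMr; apply: powR_cvg => //; apply: cvgB => //; exact: cvg_cst.
apply: cvgMr; apply: cvgM; first exact: powR_cvg.
have ts : t / v @[v --> s^'-] --> t / s.
  by apply: cvgMr; apply: cvgV => //; rewrite gt_eqF.
have ts1 : 1 < t / s by rewrite ltr_pdivlMr// mul1r.
exact: (continuous_cvg _ (volterra_int_continuous aN1 a1 ts1) ts).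
Unshelve. all: by end_near. Qed.

(** Rescaling the integral of [fbm_kernel H t s] turns [s^(-a)] into [s^a]. The denominator is
    written as [e + 1] with [e = H - 1/2], as [Rintegral_asymptotic] delivers it. *)
Lemma cond_cov_constE H s t : 0 < H -> H < 1 -> 0 < s -> s < t ->
  cond_cov_const H t s = fbm_kernel H t s * fbm_const H / (H - 1 / 2 + 1).
Proof.
move=> H0 H1 s0 st; set a := H - 1 / 2.
have aN1 : -1 < a by rewrite /a; lra.
have a1 : a < 1 by rewrite /a; lra.
have scale := volterra_int_scale t aN1 a1 s0.
rewrite /cond_cov_const /fbm_kernel -/a.
rewrite (_ : 1 / 2 - H = - a); last by rewrite /a; ring.
rewrite (_ : H - 3 / 2 = a - 1); last by rewrite /a; field.
rewrite (_ : H + 1 / 2 = a + 1); last by rewrite /a; field.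
rewrite -/(volterra_int a t s) -/(volterra_int a (t / s) 1) scale.
have E : s `^ a = s `^ (- a) * s `^ (2 * a).
  by rewrite -powRD ?(@gt_eqF _ _ s) ?implybT//; congr (_ `^ _); ring.
rewrite E; move: (fbm_const H) (volterra_int _ _ _) (s `^ _) (s `^ _) ((t / s) `^ _) ((t - s) `^ _) => x1 x2 x3 x4 x5 x6.
by field; rewrite gt_eqF; lra.
Qed.

End Asymptotics.

(** * The two expansions of the conditional covariance *)

Section ConditionalCovariance.
Variable R : realType.
Implicit Types (c e s t u v H : R).

(** Common to both expansions; [e] is the order of the product of kernels at [v = s]. *)
Lemma fbm_cond_cov_asymptotic H s t c e (h : R -> R) :
  0 < H -> H < 1 -> H != 1 / 2 -> 0 < s -> s <= t -> -1 < e ->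
  (\forall v \near s^'-, fbm_kernel H t v * fbm_kernel H s v = h v * (s - v) `^ e) ->
  h v @[v --> s^'-] --> c ->
  (fun u => fbm_cond_cov H t s u) = (fun u => c / (e + 1) * (s - u) `^ (e + 1))
    +o_ (s^'-) (fun u => (s - u) `^ (e + 1)).
Proof.
move=> H0 H1 Hn s0 st e1 hE hc; apply/eqaddoP => eps eps0.
have Ki := integrable_fbm_kernel H0 H1 Hn s0 st.
have near0 : \forall u \near s^'-, 0 < u by exact: nbhs_left_gt.
have near_int : \forall u \near s^'-, (@lebesgue_measure R).-integrable `]u, s[
    (EFin \o (fun v => fbm_kernel H t v * fbm_kernel H s v)).
  near=> u; have u0 : 0 < u by near: u.
  apply: integrableS Ki => // v /=; rewrite !in_itv/= => /andP[uv ->].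
  by rewrite (lt_trans u0 uv).
have asym := Rintegral_asymptotic e1 near_int hE hc eps0.
near=> u.
have u0 : 0 < u by near: u.
have us : u < s by near: u; exact: nbhs_left_lt.
suff : `|fbm_cond_cov H t s u - c / (e + 1) * (s - u) `^ (e + 1)|
    <= eps * `|(s - u) `^ (e + 1)| by [].
rewrite fbm_cond_covE// [X in _ <= _ * X]ger0_norm ?powR_ge0//.
by near: u; exact: asym.
Unshelve. all: by end_near. Qed.

End ConditionalCovariance.

Unset Implicit Arguments.

Theorem proposition3p3 (R : realType) (H t s : R)
  (H_gt0 : 0 < H) (H_lt1 : H < 1) (H_neq : H != 1 / 2)
  (s_gt0 : 0 < s) (s_le_t : s <= t) :
  (t = s ->
    (fun u : R => fbm_cond_cov H s s u) =
    (fun u : R => fbm_const H ^+ 2 / (2 * H) * (s - u) `^ (2 * H))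
    +o_ (s^'-) (fun u : R => (s - u) `^ (2 * H)))
  /\
  (s < t ->
    (fun u : R => fbm_cond_cov H t s u) =
    (fun u : R => cond_cov_const H t s * (s - u) `^ (H + 1 / 2))
    +o_ (s^'-) (fun u : R => (s - u) `^ (H + 1 / 2))).
Proof.
pose a := H - 1 / 2.
have ae : a + 1 = H + 1 / 2 by rewrite /a; field.
have aae : 2 * a + 1 = 2 * H by rewrite /a; field.
have pow1 v : v < s -> (s - v) `^ (- a) * (s - v) `^ a = 1.
  move=> vs; have sv0 : 0 < s - v by rewrite subr_gt0.
  by rewrite -powRD ?addNr ?powRr0// (@gt_eqF _ _ (s - v)) ?implybT.
have diag := fbm_kernel_diag_cvg H_gt0 H_lt1 s_gt0.
split => [_|st].
(* On the diagonal each of the two kernels contributes [(s - v)^a], so [e = 2a], and [e + 1 = 2 H]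
   gives the constant. *)
- rewrite -aae; apply: (@fbm_cond_cov_asymptotic R H s s (fbm_const H ^+ 2) (2 * a)
    (fun v => (fbm_kernel H s v * (s - v) `^ (- a)) ^+ 2)) => //.
  + by rewrite /a; lra.
  + near=> v; have vs : v < s by near: v; exact: nbhs_left_lt.
    have sv0 : 0 < s - v by rewrite subr_gt0.
    have E : (s - v) `^ (2 * a) = (s - v) `^ a ^+ 2.
      by rewrite mulrC powRrM powR_mulrn ?powR_ge0.
    transitivity ((fbm_kernel H s v * ((s - v) `^ (- a) * (s - v) `^ a)) ^+ 2).
      by rewrite pow1// mulr1 expr2.
    by rewrite E mulrA [LHS]exprMn.
  + by rewrite expr2; apply: cvgM.
- have cE : cond_cov_const H t s = fbm_kernel H t s * fbm_const H / (a + 1).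
    by apply: cond_cov_constE.
  (* For [t > s] the kernel at [t] has a finite limit, so only the kernel at [s] contributes and
     [e = a]. *)
  rewrite cE -ae; apply: (@fbm_cond_cov_asymptotic R H s t _ a
    (fun v => fbm_kernel H t v * (fbm_kernel H s v * (s - v) `^ (- a)))) => //.
  + by rewrite /a; lra.
  + near=> v; have vs : v < s by near: v; exact: nbhs_left_lt.
    transitivity (fbm_kernel H t v * (fbm_kernel H s v * ((s - v) `^ (- a) * (s - v) `^ a))).
      by rewrite pow1// mulr1.
    by rewrite !mulrA.
  + by apply: cvgM; [exact: fbm_kernel_cvg|exact: diag].
Unshelve. all: by end_near. Qed.
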